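(* Let $\mathcal F$ be a foliation of codimension $2q$, $q\ge 1$, on $M$, and let $\nabla$ be an adapted connection of $N\mathcal F$ with associated $\hat{\mathcal F}$-transversal almost complex structures $\mathcal I_1,\mathcal I_2$ on $\mathcal Z(\mathcal F)$. (1) $\mathcal I_1$ is projectable if and only if either (i) $q\ge2$, and for all $x\in M$, $Y\in F_x$, $X,Z\in T_xM$ one has $$R_\nabla(X,Y)\pi_NZ=\lambda(X,Y)\pi_NZ+\mu(Z,Y)\pi_NX,$$ where, necessarily, the coefficients $\lambda,\mu$ are given by $$\lambda(X,Y)=\tfrac{1}{4q^2-1}\big(2q\,tr\,R_\nabla(X,Y)-Ric_\nabla(Y,X)\big)=\tfrac{1}{2q+1}tr\,R_\nabla(X,Y)+\tfrac{1}{4q^2-1}tr\,i(X)\nabla_YT_\nabla,$$ $$\mu(X,Y)=\tfrac{1}{1-4q^2}\big(tr\,R_\nabla(X,Y)-2q\,Ric_\nabla(Y,X)\big)=\tfrac{1}{2q+1}tr\,R_\nabla(X,Y)-\tfrac{2q}{4q^2-1}tr\,i(X)\nabla_YT_\nabla;$$ or (ii) $q=1$, and for all $x\in M$, $Y\in F_x$, $X\in T_xM$, $$R_\nabla(X,Y)\pi_NX=\nu(X,Y)\pi_NX,$$ where necessarily $$\nu(X,Y)=\tfrac13[tr\,R_\nabla(X,Y)+Ric_\nabla(Y,X)]=\tfrac23tr\,R_\nabla(X,Y)-\tfrac13tr\,i(X)\nabla_YT_\nabla.$$ (2) For all $q$, $\mathcal I_2$ is projectable if and only if, for all $x\in M$,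 $Y\in F_x$, $X\in T_xM$, $$R_\nabla(X,Y)=\alpha(X,Y)\,Id,$$ where $Id$ is the identity mapping of $N\mathcal F$ and, necessarily, $\alpha(X,Y)=\frac1{2q}tr\,R_\nabla(X,Y)$; and in this case the structure $\mathcal I_1$ must also be projectable.
   Context: All objects are $C^\infty$. $(M,\mathcal F)$ is a manifold of dimension $n=p+2q$ with a foliation $\mathcal F$ of codimension $2q$; $F=T\mathcal F\subset TM$, $N\mathcal F=TM/F$, $\pi_N:TM\to N\mathcal F$ is the projection, $\Gamma$ denotes sections. A vector field $X$ (on an open set) is foliated if $[X,Y]\in\Gamma F$ for all $Y\in\Gamma F$; a section of $N\mathcal F$ is foliated if locally it is $\pi_N X$ with $X$ foliated. An adapted (Bott) connection is a linear connection $\nabla$ on $N\mathcal F$ with $\nabla_Y(\pi_NX)=\pi_N[Y,X]$ for $Y\in\Gamma F$, $X\in\Gamma TM$. Curvature: $R_\nabla(X,Y)=\nabla_X\nabla_Y-\nabla_Y\nabla_X-\nabla_{[X,Y]}\in End\,N\mathcal F$ (zero if $X,Y\in F$). Torsion: $T_\nabla(X,Y)=\nabla_X(\pi_NY)-\nabla_Y(\pi_NX)-\pi_N[X,Y]$; it vanishes if one argument is in $F$, so it is a section of $\wedge^2N^*\mathcal F\otimes N\mathcal F$, and $\nabla_YT_\nabla$ is its covariant derivative as such. For $Y\in F_x$, $X\in T_xM$, $i(X)\nabla_YT_\nabla$ is the endomorphism $\pi_NZ\mapsto(\nabla_YT_\nabla)(X,Z)$ of $N_x\mathcal F$, and $Ric_\nabla(Y,X)=tr[\pi_NZ\mapsto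 R_\nabla(Z,Y)\pi_NX]$. Transversal twistor space: $\mathcal Z(\mathcal F)=\{J\in End(N_x\mathcal F): J^2=-Id,\ x\in M\}$, with projection $Q:\mathcal Z(\mathcal F)\to M$. An adapted connection $\nabla$ gives $T\mathcal Z(\mathcal F)=\mathcal H\oplus\mathcal V$, where $\mathcal V=\ker Q_*$ and $\mathcal H$ is the distribution of velocities of $\nabla$-parallel curves. The lifted foliation $\hat{\mathcal F}$ has as tangent space at $J$ the horizontal lift of $F_{Q(J)}$ (independent of the choice of adapted connection). One identifies $\mathcal V_J=\{A\in End(N_{Q(J)}\mathcal F): AJ+JA=0\}$, and $N\hat{\mathcal F}=T\mathcal Z(\mathcal F)/T\hat{\mathcal F}\cong Q^*N\mathcal F\oplus\mathcal V$ (via $\mathcal H/T\hat{\mathcal F}\cong Q^*N\mathcal F$). The connection $\nabla$ defines two complex structures of the bundle $N\hat{\mathcal F}$: $\mathcal I_1(v,A)=(Jv,J\circ A)$, $\mathcal I_2(v,A)=(Jv,-J\circ A)$ at $J$. $\mathcal I_a$ is ($\hat{\mathcal F}$-)projectable if it maps foliated local sections of $N\hat{\mathcal F}$ to foliated sections, i.e. it is locally the lift of an almost complex structure of the local slice spaces (local leaf spaces) of $\hat{\mathcal F}$.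
   Formalization: In the second expressions for λ, μ and ν the sign of the term in tr i(X)∇_Y T is reversed (λ: −, μ: +, ν: +), since with the stated conventions Ric(Y,X) = tr R(X,Y) + tr i(X)∇_Y T and the printed signs are inconsistent with the first expressions. *)

(* Defs.v *)
From mathcomp Require Import all_boot all_order all_algebra.
From mathcomp Require Import all_classical all_reals all_analysis.

Set Implicit Arguments.
Unset Strict Implicit.
Unset Printing Implicit Defensive.

Import Order.TTheory GRing.Theory Num.Theory.
Import numFieldNormedType.Exports.

Local Open Scope classical_set_scope.
Local Open Scope ring_scope.

Fixpoint iter_derive (R : realType) (E W : normedModType R) (vs : seq E)
    (f : E -> W) : E -> W :=
  if vs is v :: vs' then iter_derive vs' (fun x => 'D_v f x) else f.

(* C^infinity on the (open) set U; E and W are finite dimensional below. *)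
Definition smooth_on (R : realType) (E W : normedModType R) (U : set E)
    (f : E -> W) : Prop :=
  forall (vs : seq E) (x : E), U x -> differentiable (iter_derive vs f) x.

(* Lie bracket of vector fields on an open subset of a vector space. *)
Definition bracket (R : realType) (E : normedModType R) (X Y : E -> E)
    (x : E) : E :=
  'D_(X x) Y x - 'D_(Y x) X x.

(* A smooth manifold of dimension p + m with a foliation of codimension m,
   given by a foliated atlas: in the coordinates col_mx a b of a chart, with
   a : 'cV_p and b : 'cV_m, the plaques are b = constant, and the transverse
   coordinates b of one chart depend locally only on those of another one.
   [fol_phi i] and [fol_psi i] are meaningful only on [fol_dom i] and on its
   image. *)
Record foliated_atlas (R : realType) (M : topologicalType) (p m : nat) :=
  FoliatedAtlas {
  fol_idx : Type;
  fol_dom : fol_idx -> set M;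
  fol_phi : fol_idx -> M -> 'cV[R]_(p + m);
  fol_psi : fol_idx -> 'cV[R]_(p + m) -> M;
  fol_cover : forall x : M, exists i, fol_dom i x;
  fol_dom_open : forall i, open (fol_dom i);
  fol_img_open : forall i, open (fol_phi i @` fol_dom i);
  fol_phiK : forall i x, fol_dom i x -> fol_psi i (fol_phi i x) = x;
  fol_phi_continuous : forall i x, fol_dom i x ->
    {for x, continuous (fol_phi i)};
  fol_psi_continuous : forall i u, (fol_phi i @` fol_dom i) u ->
    {for u, continuous (fol_psi i)};
  fol_smooth : forall i j,
    smooth_on (fol_phi i @` (fol_dom i `&` fol_dom j))
      (fun u => fol_phi j (fol_psi i u));
  fol_foliated : forall i j u (a : 'cV[R]_p),
    (fol_phi i @` (fol_dom i `&` fol_dom j)) u ->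
    'D_(col_mx a 0) (fun u' => dsubmx (fol_phi j (fol_psi i u'))) u = 0 }.

Definition fol_img (R : realType) (M : topologicalType) (p m : nat)
    (F : foliated_atlas R M p m) (i : fol_idx F) : set 'cV[R]_(p + m) :=
  fol_phi i @` fol_dom i.

Definition fol_trans (R : realType) (M : topologicalType) (p m : nat)
    (F : foliated_atlas R M p m) (i j : fol_idx F)
    (u : 'cV[R]_(p + m)) : 'cV[R]_(p + m) :=
  fol_phi j (fol_psi i u).

(* Tangent vectors at x are represented by their components xi : 'cV_(p + m)
   in a chart at x. F is the bundle of the xi with dsubmx xi = 0, so that
   N F = TM / F has components in 'cV_m, with projection pi_N = dsubmx;
   [lift_N w] is a vector projecting onto w. *)
Definition in_F (R : realType) (p m : nat) (xi : 'cV[R]_(p + m)) : Prop :=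
  dsubmx xi = 0.

Definition lift_N (R : realType) (p m : nat) (w : 'cV[R]_m) :
    'cV[R]_(p + m) := col_mx 0 w.

(* The transition matrices of N F. *)
Definition jac_N (R : realType) (M : topologicalType) (p m : nat)
    (F : foliated_atlas R M p m) (i j : fol_idx F) (u : 'cV[R]_(p + m)) :
    'M[R]_m :=
  \matrix_(a, b) (dsubmx ('D_(lift_N p (delta_mx b 0)) (fol_trans i j) u)) a 0.

(* A linear connection on N F, given by its connection matrices in the frames
   of N F defined by the charts. In [conn_glue], the section of components s
   in the chart i has the components jac_N i j *m s in the chart j. *)
Record connection (R : realType) (M : topologicalType) (p m : nat)
    (F : foliated_atlas R M p m) := Connection {
  conn_form : fol_idx F -> 'cV[R]_(p + m) -> 'cV[R]_(p + m) -> 'M[R]_m;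
  conn_linear : forall i u, fol_img i u -> linear (conn_form i u);
  conn_smooth : forall i xi, smooth_on (fol_img i) (fun u => conn_form i u xi);
  conn_glue : forall i j u xi,
    (fol_phi i @` (fol_dom i `&` fol_dom j)) u ->
    'D_xi (jac_N i j) u
      + conn_form j (fol_trans i j u) ('D_xi (fol_trans i j) u) *m jac_N i j u
    = jac_N i j u *m conn_form i u xi }.

(* The covariant derivative nabla_X s, in the chart i. *)
Definition cov (R : realType) (M : topologicalType) (p m : nat)
    (F : foliated_atlas R M p m) (nabla : connection F) (i : fol_idx F)
    (X : 'cV[R]_(p + m) -> 'cV[R]_(p + m)) (s : 'cV[R]_(p + m) -> 'cV[R]_m)
    (u : 'cV[R]_(p + m)) : 'cV[R]_m :=
  'D_(X u) s u + conn_form nabla i u (X u) *m s u.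

Definition adapted (R : realType) (M : topologicalType) (p m : nat)
    (F : foliated_atlas R M p m) (nabla : connection F) : Prop :=
  forall (i : fol_idx F) (W : set 'cV[R]_(p + m))
    (X Y : 'cV[R]_(p + m) -> 'cV[R]_(p + m)),
  open W -> W `<=` fol_img i -> smooth_on W X -> smooth_on W Y ->
  (forall u, W u -> in_F (Y u)) ->
  forall u, W u ->
    cov nabla i Y (fun u' => dsubmx (X u')) u = dsubmx (bracket Y X u).

Definition curv (R : realType) (M : topologicalType) (p m : nat)
    (F : foliated_atlas R M p m) (nabla : connection F) (i : fol_idx F)
    (X Y : 'cV[R]_(p + m) -> 'cV[R]_(p + m)) (s : 'cV[R]_(p + m) -> 'cV[R]_m)
    (u : 'cV[R]_(p + m)) : 'cV[R]_m :=
  cov nabla i X (cov nabla i Y s) u - cov nabla i Y (cov nabla i X s) u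
    - cov nabla i (bracket X Y) s u.

Definition tors (R : realType) (M : topologicalType) (p m : nat)
    (F : foliated_atlas R M p m) (nabla : connection F) (i : fol_idx F)
    (X Y : 'cV[R]_(p + m) -> 'cV[R]_(p + m)) (u : 'cV[R]_(p + m)) : 'cV[R]_m :=
  cov nabla i X (fun u' => dsubmx (Y u')) u
    - cov nabla i Y (fun u' => dsubmx (X u')) u
    - dsubmx (bracket X Y u).

(* The torsion as a section of Lambda^2 N*F (x) N F, and its covariant
   derivative nabla_Y T evaluated on the sections s, t of N F. *)
Definition tors_N (R : realType) (M : topologicalType) (p m : nat)
    (F : foliated_atlas R M p m) (nabla : connection F) (i : fol_idx F)
    (s t : 'cV[R]_(p + m) -> 'cV[R]_m) : 'cV[R]_(p + m) -> 'cV[R]_m :=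
  tors nabla i (fun u => lift_N p (s u)) (fun u => lift_N p (t u)).

Definition cov_tors_N (R : realType) (M : topologicalType) (p m : nat)
    (F : foliated_atlas R M p m) (nabla : connection F) (i : fol_idx F)
    (Y : 'cV[R]_(p + m) -> 'cV[R]_(p + m))
    (s t : 'cV[R]_(p + m) -> 'cV[R]_m) (u : 'cV[R]_(p + m)) : 'cV[R]_m :=
  cov nabla i Y (tors_N nabla i s t) u
    - tors_N nabla i (cov nabla i Y s) t u
    - tors_N nabla i s (cov nabla i Y t) u.

(* Values of these tensors at x on vectors given by their components in the
   chart i at x, computed on the extensions with constant components:
   R(X,Y)w for w in N_x F, and (nabla_Y T)(X,Z). *)
Definition riem (R : realType) (M : topologicalType) (p m : nat)
    (F : foliated_atlas R M p m) (nabla : connection F) (i : fol_idx F)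
    (x : M) (X Y : 'cV[R]_(p + m)) (w : 'cV[R]_m) : 'cV[R]_m :=
  curv nabla i (cst X) (cst Y) (cst w) (fol_phi i x).

Definition nabla_tors (R : realType) (M : topologicalType) (p m : nat)
    (F : foliated_atlas R M p m) (nabla : connection F) (i : fol_idx F)
    (x : M) (Y X Z : 'cV[R]_(p + m)) : 'cV[R]_m :=
  cov_tors_N nabla i (cst Y) (cst (dsubmx X)) (cst (dsubmx Z)) (fol_phi i x).

Definition tr_end (R : realType) (m : nat) (f : 'cV[R]_m -> 'cV[R]_m) : R :=
  \sum_(a < m) (f (delta_mx a 0)) a 0.

Definition tr_riem (R : realType) (M : topologicalType) (p m : nat)
    (F : foliated_atlas R M p m) (nabla : connection F) (i : fol_idx F)
    (x : M) (X Y : 'cV[R]_(p + m)) : R :=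
  tr_end (riem nabla i x X Y).

(* Ric(Y,X) = tr [pi_N Z |-> R(Z,Y) pi_N X], for Y in F. *)
Definition ric (R : realType) (M : topologicalType) (p m : nat)
    (F : foliated_atlas R M p m) (nabla : connection F) (i : fol_idx F)
    (x : M) (Y X : 'cV[R]_(p + m)) : R :=
  tr_end (fun w => riem nabla i x (lift_N p w) Y (dsubmx X)).

(* tr i(X) nabla_Y T. For an adapted connection and Y in F, the first Bianchi
   identity reads R(X,Y) pi_N Z - R(Z,Y) pi_N X = - (nabla_Y T)(X,Z), whence
   Ric(Y,X) = tr R(X,Y) + tr i(X) nabla_Y T. *)
Definition tr_nabla_tors (R : realType) (M : topologicalType) (p m : nat)
    (F : foliated_atlas R M p m) (nabla : connection F) (i : fol_idx F)
    (x : M) (X Y : 'cV[R]_(p + m)) : R :=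
  tr_end (fun w => nabla_tors nabla i x Y X (lift_N p w)).

(* The part over the chart i of the twistor space Z(F), in the trivialization
   (x, J) |-> (coordinates of x, matrix of J) defined by the chart. It is a
   submanifold of 'cV_(p + m) * 'M_m, whose tangent space at (u, J) consists
   of the (xi, B) with B J + J B = 0. Vector fields on an open part of it are
   represented by smooth extensions to an open set O of the ambient space, and
   only their values on the submanifold matter; as they are tangent to it, this
   also holds for their brackets. All the notions below being local, it is
   enough to consider fields and sections over open sets O of this kind. *)
Definition twistor (R : realType) (M : topologicalType) (p m : nat)
    (F : foliated_atlas R M p m) (i : fol_idx F) :
    set ('cV[R]_(p + m) * 'M[R]_m) :=
  [set z | fol_img i z.1 /\ z.2 *m z.2 = - 1%:M].

Definition twistor_vfield (R : realType) (M : topologicalType) (p m : nat)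
    (F : foliated_atlas R M p m) (i : fol_idx F)
    (O : set ('cV[R]_(p + m) * 'M[R]_m))
    (X : 'cV[R]_(p + m) * 'M[R]_m -> 'cV[R]_(p + m) * 'M[R]_m) : Prop :=
  smooth_on O X /\
  forall z, O z -> twistor i z -> (X z).2 *m z.2 + z.2 *m (X z).2 = 0.

(* The projection of T Z(F) onto the vertical bundle along the horizontal
   bundle H: if (xi, B) is the velocity of a curve J(t) in Z(F), then
   [vert z (xi, B)] is the covariant derivative of J(t) for the connection
   induced on End N F. In particular H is the kernel of [vert]. *)
Definition vert (R : realType) (M : topologicalType) (p m : nat)
    (F : foliated_atlas R M p m) (nabla : connection F) (i : fol_idx F)
    (z t : 'cV[R]_(p + m) * 'M[R]_m) : 'M[R]_m :=
  t.2 + conn_form nabla i z.1 t.1 *m z.2 - z.2 *m conn_form nabla i z.1 t.1.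

(* The tangent space of the lifted foliation: the horizontal lift of F. *)
Definition in_hatF (R : realType) (M : topologicalType) (p m : nat)
    (F : foliated_atlas R M p m) (nabla : connection F) (i : fol_idx F)
    (z t : 'cV[R]_(p + m) * 'M[R]_m) : Prop :=
  in_F t.1 /\ vert nabla i z t = 0.

(* The projection of T Z(F) onto N hatF = Q^* N F (+) V. *)
Definition pi_hatN (R : realType) (M : topologicalType) (p m : nat)
    (F : foliated_atlas R M p m) (nabla : connection F) (i : fol_idx F)
    (z t : 'cV[R]_(p + m) * 'M[R]_m) : 'cV[R]_m * 'M[R]_m :=
  (dsubmx t.1, vert nabla i z t).

Definition foliated_vfield (R : realType) (M : topologicalType) (p m : nat)
    (F : foliated_atlas R M p m) (nabla : connection F) (i : fol_idx F)
    (O : set ('cV[R]_(p + m) * 'M[R]_m))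
    (X : 'cV[R]_(p + m) * 'M[R]_m -> 'cV[R]_(p + m) * 'M[R]_m) : Prop :=
  twistor_vfield i O X /\
  forall (O' : set ('cV[R]_(p + m) * 'M[R]_m))
    (Y : 'cV[R]_(p + m) * 'M[R]_m -> 'cV[R]_(p + m) * 'M[R]_m),
  open O' -> O' `<=` O -> twistor_vfield i O' Y ->
  (forall z, O' z -> twistor i z -> in_hatF nabla i z (Y z)) ->
  forall z, O' z -> twistor i z -> in_hatF nabla i z (bracket X Y z).

Definition foliated_section (R : realType) (M : topologicalType) (p m : nat)
    (F : foliated_atlas R M p m) (nabla : connection F) (i : fol_idx F)
    (O : set ('cV[R]_(p + m) * 'M[R]_m))
    (s : 'cV[R]_(p + m) * 'M[R]_m -> 'cV[R]_m * 'M[R]_m) : Prop :=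
  forall z, O z -> twistor i z ->
  exists (O' : set ('cV[R]_(p + m) * 'M[R]_m))
    (X : 'cV[R]_(p + m) * 'M[R]_m -> 'cV[R]_(p + m) * 'M[R]_m),
  [/\ open O', O' z, O' `<=` O, foliated_vfield nabla i O' X &
    forall z', O' z' -> twistor i z' -> s z' = pi_hatN nabla i z' (X z')].

Definition tw_I1 (R : realType) (m : nat) (J : 'M[R]_m)
    (t : 'cV[R]_m * 'M[R]_m) : 'cV[R]_m * 'M[R]_m :=
  (J *m t.1, J *m t.2).

Definition tw_I2 (R : realType) (m : nat) (J : 'M[R]_m)
    (t : 'cV[R]_m * 'M[R]_m) : 'cV[R]_m * 'M[R]_m :=
  (J *m t.1, - (J *m t.2)).

Definition projectable (R : realType) (M : topologicalType) (p m : nat)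
    (F : foliated_atlas R M p m) (nabla : connection F)
    (I : 'M[R]_m -> 'cV[R]_m * 'M[R]_m -> 'cV[R]_m * 'M[R]_m) : Prop :=
  forall (i : fol_idx F) (O : set ('cV[R]_(p + m) * 'M[R]_m))
    (s : 'cV[R]_(p + m) * 'M[R]_m -> 'cV[R]_m * 'M[R]_m),
  open O -> foliated_section nabla i O s ->
  foliated_section nabla i O (fun z => I z.2 (s z)).

(* The coefficients below are a priori arbitrary functions on T_xM x F_x. *)
Definition curv_cond_gen (R : realType) (M : topologicalType) (p m : nat)
    (F : foliated_atlas R M p m) (nabla : connection F) (i : fol_idx F)
    (x : M) (lambda mu : 'cV[R]_(p + m) -> 'cV[R]_(p + m) -> R) : Prop :=
  forall X Y Z : 'cV[R]_(p + m), in_F Y ->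
    riem nabla i x X Y (dsubmx Z)
    = lambda X Y *: dsubmx Z + mu Z Y *: dsubmx X.

Definition curv_cond_q1 (R : realType) (M : topologicalType) (p m : nat)
    (F : foliated_atlas R M p m) (nabla : connection F) (i : fol_idx F)
    (x : M) (nu : 'cV[R]_(p + m) -> 'cV[R]_(p + m) -> R) : Prop :=
  forall X Y : 'cV[R]_(p + m), in_F Y ->
    riem nabla i x X Y (dsubmx X) = nu X Y *: dsubmx X.

Definition curv_cond_I2 (R : realType) (M : topologicalType) (p m : nat)
    (F : foliated_atlas R M p m) (nabla : connection F) (i : fol_idx F)
    (x : M) (alpha : 'cV[R]_(p + m) -> 'cV[R]_(p + m) -> R) : Prop :=
  forall X Y : 'cV[R]_(p + m), in_F Y ->
    forall w : 'cV[R]_m, riem nabla i x X Y w = alpha X Y *: w.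

(* Main.v *)
Require Import Defs.
From HB Require Import structures.
From mathcomp Require Import all_boot all_order all_algebra.
From mathcomp Require Import all_classical all_reals all_analysis.
From mathcomp Require Import perm ring lra zify.

Set Implicit Arguments.
Unset Strict Implicit.
Unset Printing Implicit Defensive.

Import Order.TTheory GRing.Theory Num.Theory.
Import numFieldNormedType.Exports.

Local Open Scope classical_set_scope.
Local Open Scope ring_scope.

(* In a foliated chart, adaptedness says exactly that the connection matrices
   vanish on F. Hence the leaves of hatF are the sets where the transverse
   coordinates and the matrix J are constant, a vector field on the twistor
   space is foliated iff its components transverse to hatF are constant along
   these leaves, and R(X,Y)w = - (D_Y Gamma(X)) w for Y in F. Lifting a foliated
   section and applying I_1 or I_2 then shows that projectability is the
   algebraic condition
     e J [rho(a), J] = [rho(J a), J]   for all a and all J with J^2 = -1,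
   where rho(a) = - R(a,Y), with e = 1 for I_1 and e = -1 for I_2. Testing it on
   matrices J which permute the basis up to scalars, with variable scalars,
   gives linear relations among the coefficients of rho. For e = 1 they say that
   rho(a) b = l(a) b + u(b) a; for e = -1, together with their transforms under
   an elementary change of basis, that rho(a) is scalar. *)

(** * Smooth maps between normed spaces *)

(** Derivatives are taken in the ambient vector space, while only values on the submanifold J^2 = -1
    are meaningful. The link is that a function vanishing on the twistor space has zero derivative
    in its tangent directions; no parametrization is used for this, only polynomial curves of
    complex structures obtained by conjugating J with 1 + tN, N^2 = 0. Differentiation along F keeps
    J fixed, so the algebraic condition can be read off one J at a time. In the algebra, the scalars
    of a test matrix can be rescaled on each pair of exchanged indices; a tested entry is then a
    polynomial identity in one scalar and splits into its coefficients. For e = -1 and q = 1 these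
    tests still admit non-scalar rho, hence the change of basis, which treats all q at once. The
    case q = 1 of I_1 leads to the same normal form as q >= 2: in dimension two, rho(a) a parallel
    to a already polarizes to l(a) b + u(b) a. *)

Lemma near_eq_differentiable (R : numFieldType) (V W : normedModType R)
    (f g : V -> W) (x : V) :
  (\near x, f x = g x) -> differentiable f x -> differentiable g x.
Proof.
move=> fg df.
have [dfc dfo] := (diff_locallyP _ _).1 df.
have gx : g x = f x by rewrite (nbhs_singleton fg).
have go : g \o shift x = cst (g x) + 'd f x +o_ 0 id.
  rewrite gx; apply/eqaddoP => e e0.
  have /eqaddoP/(_ _ e0) := dfo.
  apply: filter_app.
  have := fg; rewrite (near_shift 0 x) /=; apply: filter_app.
  apply: nearW => y.
  by rewrite /= subr0 !fctE => ->.
by apply/diff_locallyP; rewrite (diff_unique dfc go).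
Qed.
Lemma continuous_mx_lin (R : realType) m n (W : normedModType R)
    (L : 'M[R]_(m, n) -> W) : linear L -> continuous L.
Proof.
move=> Ll; pose LM := GRing.isLinear.Build R 'M[R]_(m, n) W *:%R L Ll.
pose LL : {linear 'M[R]_(m, n) -> W} := HB.pack L LM.
have -> : L = (fun A => \sum_(i < m) \sum_(j < n) A i j *: L (delta_mx i j)).
  apply/funext => A; rewrite [in LHS](matrix_sum_delta A).
  rewrite -[L]/(LL : _ -> _) linear_sum; apply: eq_bigr => i _.
  by rewrite linear_sum; apply: eq_bigr => j _; rewrite linearZ.
apply: continuous_big => [|i _]; first exact: add_continuous.
apply: continuous_big => [|j _ A]; first exact: add_continuous.
have := @cvg_comp _ _ _ (fun M : 'M[R]_(m, n) => M i j)
  ( *:%R^~ (L (delta_mx i j))) _ _ _ (@coord_continuous R m n i j A)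
  (@scalel_continuous R W (L (delta_mx i j)) (A i j)).
exact.
Qed.

Section Derive.
Variables (R : realType) (E V W : normedModType R).

Lemma is_derive_linear (L : {linear V -> W}) (f : E -> V) x v df :
  continuous L -> is_derive x v f df -> is_derive x v (fun y => L (f y)) (L df).
Proof.
move=> Lc [fd fdf].
have H : (fun h => h^-1 *: (L (f (h *: v + x)) - L (f x))) @ 0^' --> L df.
  rewrite -fdf.
  have -> : (fun h => h^-1 *: (L (f (h *: v + x)) - L (f x))) =
      L \o (fun h => h^-1 *: (f (h *: v + x) - f x)).
    by apply/funext => h /=; rewrite linearZ -linearB.
  exact: (cvg_comp _ _ fd (Lc _)).
split; first by apply/cvg_ex; exists (L df).
exact: cvg_lim H.
Qed.

(** Agreement is required on the line alone: fields on the twistor space will be compared at a fixed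
    J, hence not on a full neighbourhood. *)
Lemma near_line_derive (f g : E -> V) x v :
  (\forall t \near (0 : R), f (t *: v + x) = g (t *: v + x)) ->
  'D_v f x = 'D_v g x.
Proof.
move=> fg; have fgx := nbhs_singleton fg; rewrite /= !scale0r !add0r in fgx.
rewrite /derive; congr (lim _).
rewrite eqEsubset; split; apply/near_eq_cvg/cvg_within;
  by move: fg; apply: filterS => t /= ->; rewrite fgx.
Qed.

Lemma derive_linear_dir (f : E -> V) x : differentiable f x ->
  linear (fun v => 'D_v f x).
Proof. by move=> df a u v; rewrite !deriveE// linearP. Qed.

End Derive.

(** * Closure properties of smooth maps *)

Section Smooth.
Variables (R : realType) (E : normedModType R) (U : set E).
Hypothesis oU : open U.

(** Smoothness graded by the number of derivatives instead of the list of directions. This makes the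
    Leibniz rule inductive: at order n + 1 it calls on products of order n, with only one factor
    differentiated. *)
Fixpoint diff_upto (W : normedModType R) n (f : E -> W) : Prop :=
  (forall x, U x -> differentiable f x) /\
  if n is n'.+1 then forall v, diff_upto n' (fun x => 'D_v f x) else True.

Lemma smooth_onP (W : normedModType R) (f : E -> W) :
  smooth_on U f <-> forall n, diff_upto n f.
Proof.
split=> [sf n|df vs x Ux].
  elim: n f sf => [|n IH] f sf; split=> //; try exact: (sf [::]).
  by move=> v; apply: IH => vs; exact: (sf (v :: vs)).
elim: vs f df => [|v vs IH] f df; first by have [+ _] := df 0%N; exact.
by apply: IH => n; have [_] := df n.+1; exact.
Qed.

Lemma diff_uptoW (W : normedModType R) n (f : E -> W) :
  diff_upto n.+1 f -> diff_upto n f.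
Proof.
elim: n f => [|n IH] f [df dDf]; split=> // v.
by apply: IH; exact: dDf.
Qed.

Lemma near_eq_on (W : normedModType R) (f g : E -> W) x :
  (forall x, U x -> f x = g x) -> U x -> \near x, f x = g x.
Proof.
move=> fg Ux; have : nbhs x U by exact: open_nbhs_nbhs.
exact: filterS.
Qed.

Lemma diff_upto_eq (W : normedModType R) n (f g : E -> W) :
  (forall x, U x -> f x = g x) -> diff_upto n f -> diff_upto n g.
Proof.
elim: n f g => [|n IH] f g fg [df dDf]; split=> //;
  try by move=> x Ux; apply: near_eq_differentiable (df x Ux);
    exact: near_eq_on.
move=> v; apply: IH (dDf v) => x Ux.
by apply: near_eq_derive; exact: near_eq_on.
Qed.

Lemma smooth_on_eq (W : normedModType R) (f g : E -> W) :
  (forall x, U x -> f x = g x) -> smooth_on U f -> smooth_on U g.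
Proof.
by move=> fg /smooth_onP sf; apply/smooth_onP => n; exact: diff_upto_eq (sf n).
Qed.

Lemma smooth_on_cst (W : normedModType R) (c : W) : smooth_on U (fun=> c).
Proof.
apply/smooth_onP => n; elim: n c => [|n IH] c; split=> //.
move=> v; apply: diff_upto_eq (IH 0) => x Ux.
by rewrite derive_cst.
Qed.

Lemma smooth_on_id : smooth_on U id.
Proof.
move=> [|v vs] x Ux; first exact: ex_diff.
rewrite /= (_ : (fun y => 'D_v id y) = fun=> v); first exact: smooth_on_cst.
by apply/funext => y; rewrite derive_id.
Qed.

Lemma smooth_on_linear (V W : normedModType R) (L : {linear V -> W})
    (f : E -> V) :
  continuous L -> smooth_on U f -> smooth_on U (fun x => L (f x)).
Proof.
move=> Lc /smooth_onP sf; apply/smooth_onP => n.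
elim: n f {sf}(sf n) => [|n IH] f [df dDf]; split=> //;
  try by move=> x Ux; apply: (@differentiable_comp _ _ _ _ f L);
    [exact: df|exact: linear_differentiable].
move=> v; apply: diff_upto_eq (IH _ (dDf v)) => x Ux.
have /derivableP fx : derivable f x v by apply: diff_derivable; exact: df.
by have [_ ->] := is_derive_linear Lc fx.
Qed.

Lemma diff_uptoD (W : normedModType R) n (f g : E -> W) :
  diff_upto n f -> diff_upto n g -> diff_upto n (fun x => f x + g x).
Proof.
elim: n f g => [|n IH] f g [df dDf] [dg dDg]; split=> //;
  try by move=> x Ux;
    apply: (@differentiableD _ _ _ f g); [exact: df|exact: dg].
move=> v; apply: diff_upto_eq (IH _ _ (dDf v) (dDg v)) => x Ux.
rewrite -[fun x => f x + g x]/(f + g) deriveD//; apply: diff_derivable.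
  exact: df.
exact: dg.
Qed.

Lemma smooth_onD (W : normedModType R) (f g : E -> W) :
  smooth_on U f -> smooth_on U g -> smooth_on U (fun x => f x + g x).
Proof.
move=> /smooth_onP sf /smooth_onP sg; apply/smooth_onP => n.
exact: diff_uptoD.
Qed.

Lemma smooth_onM (f g : E -> R) :
  smooth_on U f -> smooth_on U g -> smooth_on U (fun x => f x * g x).
Proof.
move=> /smooth_onP sf /smooth_onP sg; apply/smooth_onP => n.
elim: n f g {sf sg}(sf n) (sg n) => [|n IH] f g;
  move=> /[dup] Df [df dDf] /[dup] Dg [dg dDg];
  split=> //;
  try by move=> x Ux; apply: (@differentiableM _ _ f g); [exact: df|exact: dg].
move=> v; apply: diff_upto_eq (diff_uptoD (IH _ _ (diff_uptoW Df) (dDg v))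
  (IH _ _ (dDf v) (diff_uptoW Dg))) => x Ux.
rewrite -[fun x => f x * g x]/(f * g) deriveM; first last.
- by apply: diff_derivable; exact: dg.
- by apply: diff_derivable; exact: df.
by rewrite [X in _ + X]mulrC.
Qed.

End Smooth.
Section LinearMaps.
Variables (R : realType) (E V W : normedModType R).

Lemma is_derive_lin (L : V -> W) (f : E -> V) x v df :
  linear L -> continuous L ->
  is_derive x v f df -> is_derive x v (fun y => L (f y)) (L df).
Proof.
move=> Ll; pose LM := GRing.isLinear.Build R V W *:%R L Ll.
pose LL : {linear V -> W} := HB.pack L LM.
exact: (@is_derive_linear R E V W LL).
Qed.

Lemma smooth_on_lin (U : set E) (L : V -> W) (f : E -> V) : open U ->
  linear L -> continuous L -> smooth_on U f -> smooth_on U (fun x => L (f x)).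
Proof.
move=> oU Ll; pose LM := GRing.isLinear.Build R V W *:%R L Ll.
pose LL : {linear V -> W} := HB.pack L LM.
exact: (@smooth_on_linear R E U oU V W LL).
Qed.

Lemma smooth_onS (U U' : set E) (f : E -> V) :
  U' `<=` U -> smooth_on U f -> smooth_on U' f.
Proof. by move=> UU sf vs x /UU; exact: sf. Qed.

Lemma smooth_on_fst (U : set E) (f : E -> V) (O : set (E * W)) :
  (forall z, O z -> U z.1) -> smooth_on U f -> smooth_on O (fun z => f z.1).
Proof.
move=> OU sf vs z /OU Uz.
have -> : iter_derive vs (fun z : E * W => f z.1) =
    (fun z => iter_derive (map fst vs) f z.1).
  (* By conversion, the difference quotient of [f z.1] along [v] is that of [f] along [v.1]. *)
  by elim: vs f {sf} => //= v vs IH f; rewrite -IH.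
apply: (@differentiable_comp _ _ _ _ fst); last exact: sf.
by apply: linear_differentiable => y; exact: cvg_fst.
Qed.

Lemma fst_cont : continuous (fst : V * W -> V).
Proof. by move=> y; exact: cvg_fst. Qed.

Lemma snd_cont : continuous (snd : V * W -> W).
Proof. by move=> y; exact: cvg_snd. Qed.

End LinearMaps.

Section SmoothConstructions.
Variables (R : realType) (E : normedModType R) (U : set E).
Hypothesis oU : open U.

Lemma smooth_on_pair (V W : normedModType R) (f : E -> V) (g : E -> W) :
  smooth_on U f -> smooth_on U g -> smooth_on U (fun x => (f x, g x)).
Proof.
move=> sf sg.
have -> : (fun x => (f x, g x)) =
    (fun x => (f x, 0) + (0, g x) : (V * W)%type).
  by apply/funext => x; congr pair; rewrite /= ?addr0 ?add0r.
apply: smooth_onD => //.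
  apply: (@smooth_on_lin _ _ _ _ _ (fun v => (v, 0) : (V * W)%type)) sf => //.
    by move=> a u v; congr pair; rewrite /= ?scaler0 ?addr0.
  by move=> y; apply: cvg_pair => //; exact: cvg_cst.
apply: (@smooth_on_lin _ _ _ _ _ (fun v => (0, v) : (V * W)%type)) sg => //.
  by move=> a u v; congr pair; rewrite /= ?scaler0 ?addr0.
by move=> y; apply: cvg_pair => //; exact: cvg_cst.
Qed.

Lemma smooth_on_mx_lin m n (W : normedModType R) (L : 'M[R]_(m, n) -> W)
    (f : E -> 'M[R]_(m, n)) :
  linear L -> smooth_on U f -> smooth_on U (fun x => L (f x)).
Proof.
by move=> Ll; apply: smooth_on_lin => //; exact: continuous_mx_lin.
Qed.

Lemma smooth_on_sum (W : normedModType R) (I : Type) (r : seq I)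
    (f : I -> E -> W) :
  (forall i, smooth_on U (f i)) -> smooth_on U (fun x => \sum_(i <- r) f i x).
Proof.
move=> sf; elim: r => [|i r IH].
  by apply: smooth_on_eq (smooth_on_cst oU 0) => // x _; rewrite big_nil.
apply: smooth_on_eq (smooth_onD oU (sf i) IH) => // x _.
by rewrite big_cons.
Qed.

Lemma smooth_on_mxP m n (f : E -> 'M[R]_(m, n)) :
  smooth_on U f <-> forall i j, smooth_on U (fun x => f x i j : R).
Proof.
split=> [sf i j|sf].
  apply: (@smooth_on_mx_lin m n R (fun A => A i j)) => // a u v.
  by rewrite !mxE.
apply: (@smooth_on_eq _ _ _ oU _
  (fun x => \sum_(i < m) \sum_(j < n) f x i j *: delta_mx i j)) => [x _|].
  by rewrite -matrix_sum_delta.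
apply: smooth_on_sum => i; apply: smooth_on_sum => j.
apply: (@smooth_on_lin R E R _ U (fun t => t *: delta_mx i j)) => //.
  by move=> a u v; rewrite scalerDl scalerA.
exact: scalel_continuous.
Qed.

Lemma smooth_on_mulmx m n k (f : E -> 'M[R]_(m, n)) (g : E -> 'M[R]_(n, k)) :
  smooth_on U f -> smooth_on U g -> smooth_on U (fun x => f x *m g x).
Proof.
move=> /smooth_on_mxP sf /smooth_on_mxP sg; apply/smooth_on_mxP => i j.
apply: (@smooth_on_eq _ _ _ oU _ (fun x => \sum_(l < n) f x i l * g x l j)).
  by move=> x _; rewrite mxE.
by apply: smooth_on_sum => l; exact: smooth_onM.
Qed.

Lemma smooth_onZ (W : normedModType R) (c : R) (f : E -> W) :
  smooth_on U f -> smooth_on U (fun x => c *: f x).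
Proof.
apply: (@smooth_on_lin R E W W U (fun w => c *: w)) => //.
  by move=> a u v; rewrite scalerDr !scalerA mulrC.
exact: scaler_continuous.
Qed.

Lemma smooth_onB (W : normedModType R) (f g : E -> W) :
  smooth_on U f -> smooth_on U g -> smooth_on U (fun x => f x - g x).
Proof.
move=> sf sg.
apply: smooth_on_eq (smooth_onD oU sf (smooth_onZ (-1) sg)) => // x _.
by rewrite scaleN1r.
Qed.

Lemma smooth_on_scale m n (f : E -> R) (g : E -> 'M[R]_(m, n)) :
  smooth_on U f -> smooth_on U g -> smooth_on U (fun x => f x *: g x).
Proof.
move=> sf /smooth_on_mxP sg; apply/smooth_on_mxP => i j.
apply: (@smooth_on_eq _ _ _ oU _ (fun x => f x * g x i j)).
  by move=> x _; rewrite mxE.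
exact: smooth_onM.
Qed.

End SmoothConstructions.
(** * Derivatives along the twistor space *)

(* The square-zero matrices span the matrices of trace zero. *)
Lemma linear_sqr0_eq0 (R : realType) m (W : lmodType R)
    (psi : {linear 'M[R]_m -> W}) :
  (forall N, N *m N = 0 -> psi N = 0) -> psi 1%:M = 0 -> forall C, psi C = 0.
Proof.
move=> psi0 psi1 C.
have off k l : k != l -> psi (delta_mx k l) = 0.
  by move=> kl; apply: psi0; rewrite mul_delta_mx_cond eq_sym (negPf kl).
have diag k l : psi (delta_mx k k) = psi (delta_mx l l).
  have [->//|kl] := eqVneq k l.
  have lk : l != k by rewrite eq_sym.
  (* This matrix is the column e_k + e_l times the row e_k - e_l; the row kills the column, so the
     square is zero. *)
  have /psi0 : (delta_mx k k - delta_mx k l + delta_mx l k - delta_mx l l)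
      *m (delta_mx k k - delta_mx k l + delta_mx l k - delta_mx l l) = 0
      :> 'M[R]_m.
    rewrite !(mulmxDl, mulmxDr, mulNmx, mulmxN) !mul_delta_mx_cond !eqxx.
    rewrite (negPf kl) (negPf lk) !mulr1n !mulr0n !oppr0 !addr0 !add0r !opprK.
    by apply/matrixP => a b; rewrite !mxE; ring.
  rewrite raddfB raddfD raddfB/= (off _ _ kl) (off _ _ lk) subr0 addr0.
  exact: subr0_eq.
have d0 k : psi (delta_mx k k) = 0.
  move: psi1; rewrite scalar_mx_sum_delta linear_sum.
  under eq_bigr => i _ do rewrite scale1r (diag i k).
  rewrite sumr_const card_ord => /eqP; rewrite -scaler_nat scaler_eq0 pnatr_eq0.
  by rewrite (gtn_eqF (leq_ltn_trans (leq0n k) (ltn_ord k))) => /eqP.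
rewrite (matrix_sum_delta C) linear_sum big1// => i _.
rewrite linear_sum big1// => j _; rewrite linearZ/=.
by have [<-|ij] := eqVneq i j; rewrite ?d0 ?off// scaler0.
Qed.

Section Tangency.
Variables (R : realType) (E W : normedModType R) (m : nat).
Implicit Types (g : E * 'M[R]_m -> W) (z v : E * 'M[R]_m).

(** Chain rule at t = 0. The quadratic term does not affect the velocity, but it gives the curve the
    freedom to stay among the complex structures. *)
Lemma derive_curve (V : normedModType R) (g : V -> W) (a b z : V) (D : set V) :
  differentiable g z ->
  nbhs z D ->
  (forall t : R, let y := z + t *: a + (t * t) *: b in D y -> g y = 0) ->
  'D_a g z = 0.
Proof.
move=> dg Dz g0.
pose c t := z + t *: a + (t * t) *: b.
have dc : is_derive (0 : R) 1 c a.
  have d1 : is_derive (0 : R) 1 (fun t : R => t *: a) (1 *: a).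
    apply: (@is_derive_lin R R R V (fun t => t *: a)) => [s u w|].
    - by rewrite scalerDl scalerA.
    - exact: scalel_continuous.
  have d2 : is_derive (0 : R) 1 (fun t : R => (t * t) *: b)
      (((0 : R) *: (1 : R) + (0 : R) *: (1 : R) : R) *: b).
    apply: (@is_derive_lin R R R V (fun t => t *: b)) => [s u w||].
    - by rewrite scalerDl scalerA.
    - exact: scalel_continuous.
    - exact: is_deriveM.
  have d0 : is_derive (0 : R) 1 (fun _ : R => z) 0 by exact: is_derive_cst.
  have /= := is_deriveD (is_deriveD d0 d1) d2.
  by rewrite scale1r !scale0r addr0 scale0r addr0 add0r.
have c0 : c 0 = z by rewrite /c mulr0 !scale0r !addr0.
have [/derivable1_diffP dc1 c'] := dc.
have dgc : differentiable g (c 0) by rewrite c0.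
rewrite -c' !deriveE// -c0.
have := diff_comp dc1 dgc => /(congr1 (fun f => f 1)) /= <-.
rewrite -deriveE; last exact: differentiable_comp.
rewrite -(derive_cst (0 : W) (0 : R) 1); apply: near_eq_derive.
have : nbhs (0 : R) (c @^-1` D).
  by apply: (differentiable_continuous dc1); rewrite c0.
by apply: filterS => t; exact: g0.
Qed.

(* The vertical vector (0, JN - NJ) with N^2 = 0 is the velocity at t = 0 of the
   quadratic curve (1 - tN) J (1 + tN) of complex structures, and these vectors
   span the vertical space, since B = JC - CJ with C = - JB/2. *)
Lemma derive_tangent_eq0 g z v (U : set E) (O : set (E * 'M[R]_m)) :
  open U -> open O -> differentiable g z -> U z.1 -> O z ->
  z.2 *m z.2 = - 1%:M -> v.2 *m z.2 + z.2 *m v.2 = 0 ->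
  (forall y, O y -> U y.1 -> y.2 *m y.2 = - 1%:M -> g y = 0) ->
  'D_v g z = 0.
Proof.
case: z v => [u J] [xi B] /= oU oO dg Uu Oz JJ BJ g0.
pose D := O `&` fst @^-1` U.
have Dz : nbhs (u, J) D.
  apply: open_nbhs_nbhs; split=> //; apply: openI => //.
  by apply: open_comp => // y _; exact: cvg_fst.
have Dlin := derive_linear_dir dg.
have Dh : 'D_(xi, 0) g (u, J) = 0.
  apply: (derive_curve (b := 0) dg Dz) => t y [Oy Uy]; apply: g0 => //=.
  by rewrite !scaler0 !addr0.
have DN N : N *m N = 0 -> 'D_(0, J *m N - N *m J) g (u, J) = 0.
  move=> NN; apply: (derive_curve (b := (0, - (N *m J *m N))) dg Dz).
  move=> t y [Oy Uy]; apply: g0 => //=.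
  have -> : J + t *: (J *m N - N *m J) + (t * t) *: - (N *m J *m N) =
      (1%:M - t *: N) *m J *m (1%:M + t *: N).
    rewrite !(mulmxDl, mulmxDr, mul1mx, mulmx1, mulNmx) -!scalemxAl -!scalemxAr.
    rewrite scalerDr !scalerN !scalerA -!addrA; congr (_ + _).
  have N1 : (1%:M + t *: N) *m (1%:M - t *: N) = 1%:M.
    rewrite !(mulmxDl, mulmxDr, mul1mx, mulmx1, mulmxN) -!scalemxAl -!scalemxAr.
    by rewrite NN !scaler0 subr0 addrNK.
  have N2 : (1%:M - t *: N) *m (1%:M + t *: N) = 1%:M.
    rewrite !(mulmxDl, mulmxDr, mul1mx, mulmx1, mulNmx) -!scalemxAl -!scalemxAr.
    by rewrite NN !scaler0 subr0 addrK.
  rewrite !mulmxA -[X in X *m _ *m _]mulmxA N1 mulmx1 -[X in X *m _]mulmxA JJ.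
  by rewrite mulmxN mulmx1 mulNmx N2.
pose psi C := 'D_(0 : E, J *m C - C *m J) g (u, J).
have psil : linear psi.
  move=> a C C'; rewrite /psi -Dlin; congr ('D_ _ g _); congr pair.
    by rewrite /= scaler0 addr0.
  rewrite /= mulmxDl mulmxDr -scalemxAl -scalemxAr scalerBr opprD.
  by rewrite addrACA.
pose psiM := GRing.isLinear.Build R 'M[R]_m W *:%R psi psil.
pose psiL : {linear 'M[R]_m -> W} := HB.pack psi psiM.
(* [psi] kills the square-zero matrices thanks to the curves, and the identity because it commutes
   with J; hence it kills every matrix. *)
have psi0 : psi (- 2^-1 *: (J *m B)) = 0.
  apply: (@linear_sqr0_eq0 _ _ _ psiL) => //=.
  by rewrite /psi mulmx1 mul1mx subrr derive0.
have -> : (xi, B) = 1 *: (xi, 0) +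
    (0, J *m (- 2^-1 *: (J *m B)) - (- 2^-1 *: (J *m B)) *m J).
  congr pair; first by rewrite /= scale1r addr0.
  rewrite /= scale1r add0r -scalemxAl -scalemxAr -scalerBr mulmxA JJ -mulmxA.
  have -> : B *m J = - (J *m B) by apply/eqP; rewrite -addr_eq0 BJ.
  rewrite mulmxN opprK mulmxA JJ mulNmx mul1mx.
  by apply/matrixP => i j; rewrite !mxE; field.
by rewrite Dlin Dh scaler0 add0r.
Qed.

End Tangency.
(** * The algebraic condition on the curvature *)

(* An involution p with weights f such that f (p b) * f b = -1 encodes the
   complex structure e_b |-> f b *: e_(p b). *)
Section Pairing.
Variable R : realFieldType.

Definition pairing m (p : 'I_m -> 'I_m) (f : 'I_m -> R) : Prop :=
  involutive p /\ forall b, f (p b) * f b = -1.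

Definition pairing_mx m (p : 'I_m -> 'I_m) (f : 'I_m -> R) : 'M[R]_m :=
  \matrix_(a, b) (f b *+ (a == p b)).

Lemma pairing_mul m (p : 'I_m -> 'I_m) f (M : 'M[R]_m) k j :
  involutive p -> (pairing_mx p f *m M) k j = f (p k) * M (p k) j.
Proof.
move=> pK; rewrite mxE (bigD1 (p k))//= mxE pK eqxx mulr1n.
rewrite big1 ?addr0// => b bk.
by rewrite mxE -(inv_eq pK) eq_sym (negPf bk) mulr0n mul0r.
Qed.

Lemma mul_pairing m (p : 'I_m -> 'I_m) f (M : 'M[R]_m) k j :
  (M *m pairing_mx p f) k j = M k (p j) * f j.
Proof.
rewrite mxE (bigD1 (p j))//= mxE eqxx mulr1n big1 ?addr0// => b bj.
by rewrite mxE (negPf bj) mulr0n mulr0.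
Qed.

Lemma pairing_delta m (p : 'I_m -> 'I_m) f i :
  pairing_mx p f *m delta_mx i 0 = f i *: delta_mx (p i) 0 :> 'cV_m.
Proof.
apply/colP => k; rewrite -colE !mxE andbT.
by case: (k == p i); rewrite ?mulr1n ?mulr0n ?mulr1 ?mulr0.
Qed.

Lemma pairing_sqr m (p : 'I_m -> 'I_m) f : pairing p f ->
  pairing_mx p f *m pairing_mx p f = - 1%:M.
Proof.
move=> [pK ff]; apply/matrixP => k j; rewrite pairing_mul// !mxE inj_eq.
  have [->|_] := eqVneq k j; first by rewrite mulr1n ff.
  by rewrite !mulr0n mulr0 oppr0.
exact: inv_inj.
Qed.

Lemma pairing_neq m (p : 'I_m -> 'I_m) f b : pairing p f -> p b != b.
Proof.
move=> [_ /(_ b) fb]; apply/eqP => pb; rewrite pb -expr2 in fb.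
by have := sqr_ge0 (f b); rewrite fb oppr_ge0 ler10.
Qed.

(** Weights are invertible, so they can be cancelled from the relations obtained below. *)
Lemma pairing_neq0 m (p : 'I_m -> 'I_m) f b : pairing p f -> f b != 0.
Proof.
move=> [_ /(_ b) fb]; apply/eqP => f0; move: fb; rewrite f0 mulr0 => /eqP.
by rewrite eq_sym oppr_eq0 oner_eq0.
Qed.

Lemma pairing_conj m (p : 'I_m -> 'I_m) f (s : 'I_m -> 'I_m) :
  involutive s -> pairing p f -> pairing (s \o p \o s) (f \o s).
Proof.
by move=> sK [pK ff]; split=> b /=; [rewrite sK pK sK|rewrite sK ff].
Qed.

(** Multiplying one weight of an exchanged pair by t and the other by 1/t keeps their product equal
    to -1. This is the free scalar in which the tested identities are polynomial. *)
Lemma pairing_scale m (p : 'I_m -> 'I_m) f c t : t != 0 -> pairing p f ->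
  pairing p (fun b => if b == c then t * f b
                      else if b == p c then t^-1 * f b else f b).
Proof.
move=> t0 pf; have [pK ff] := pf; split=> // b.
have pcc := pairing_neq c pf.
have [->|bc] := eqVneq b c.
  by rewrite (negPf pcc) eqxx mulrACA mulVf// mul1r ff.
have [->|bpc] := eqVneq b (p c).
  by rewrite pK eqxx mulrACA mulfV// mul1r mulrC ff.
by rewrite (inv_eq pK) (negPf bpc) (inj_eq (inv_inj pK)) (negPf bc) ff.
Qed.

Lemma pairing_exists q : exists p f, @pairing (2 * q) p f.
Proof.
have lt (b : 'I_(2 * q)) : ((if odd b then b.-1 else b.+1) < 2 * q)%N.
  by have := ltn_ord b; case: ifP => ob; lia.
(* The standard structure, exchanging the indices 2k and 2k + 1. *)
exists (fun b => Ordinal (lt b)), (fun b => if odd b then 1 else -1).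
have odd_partner n : odd (if odd n then n.-1 else n.+1) = ~~ odd n.
  by case: n => //= n; case En: (odd n); rewrite /= En.
split=> b; last first.
  by rewrite /= odd_partner; case: (odd b); rewrite /= ?mulr1 ?mul1r.
apply: val_inj => /=; rewrite odd_partner.
by have [ob|//] := boolP (odd b); case: (val b) ob.
Qed.

Lemma pairing_exists2 q (i j : 'I_(2 * q)) : i != j ->
  exists p f, @pairing (2 * q) p f /\ p i = j.
Proof.
move=> ij; have [p [f pf]] := pairing_exists q.
exists (tperm j (p i) \o p \o tperm j (p i)), (f \o tperm j (p i)).
split; first exact: (pairing_conj (tpermK _ _) pf).
by rewrite /= (tpermD _ (pairing_neq i pf)) ?tpermR// eq_sym.
Qed.

Lemma pairing_exists4 q (i j c d : 'I_(2 * q)) : uniq [:: i; j; c; d] ->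
  exists p f, [/\ @pairing (2 * q) p f, p i = j & p c = d].
Proof.
rewrite /= !inE !negb_or => /and4P[/and3P[ij ic id] /andP[jc jd] cd _].
have [p [f [pf pij]]] := pairing_exists2 ij.
have pji : p j = i by rewrite -pij; case: pf => ->.
have pci : p c != i by rewrite -pji (inj_eq (inv_inj (proj1 pf))) eq_sym.
have pcj : p c != j by rewrite -pij (inj_eq (inv_inj (proj1 pf))) eq_sym.
(* Conjugating by the transposition of d and p c sends c to d and does not disturb i and j, since p
   c differs from both. *)
exists (tperm d (p c) \o p \o tperm d (p c)), (f \o tperm d (p c)).
split; first exact: (pairing_conj (tpermK _ _) pf).
  by rewrite /= (tpermD _ pci) ?pij ?(tpermD _ pcj) // eq_sym.
by rewrite /= (tpermD _ (pairing_neq c pf)) ?tpermR// eq_sym.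
Qed.

End Pairing.

(** * Solving the twist condition *)

Section TwistCondition.
Variable R : realFieldType.

Definition twist_cond m (e : R) (rho : 'cV[R]_m -> 'M[R]_m) : Prop :=
  forall (J : 'M[R]_m) a, J *m J = - 1%:M ->
  e *: (J *m (rho a *m J - J *m rho a)) = rho (J *m a) *m J - J *m rho (J *m a).

Section Coefficients.
Variables (q : nat) (e : R) (rho : {linear 'cV[R]_(2 * q) -> 'M[R]_(2 * q)}).
Hypotheses (e2 : e * e = 1) (rhoP : twist_cond e rho).
Let r i k j := rho (delta_mx i 0) k j.

Lemma twist_sign_neq0 : e != 0.
Proof.
apply/eqP => e0; move: e2; rewrite e0 mul0r => /eqP.
by rewrite eq_sym oner_eq0.
Qed.

(** Entry (k, j) of the condition at a = e_i, where J^2 = -1 turns J [rho, J] into J rho J + rho. *)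
Lemma twist_coef p f i k j : pairing p f ->
  e * (f (p k) * f j * r i (p k) (p j) + r i k j)
  = f i * (f j * r (p i) k (p j) - f (p k) * r (p i) (p k) j).
Proof.
move=> pf; have pK := proj1 pf.
have /matrixP/(_ k j) := @rhoP _ (delta_mx i 0) (pairing_sqr pf).
rewrite pairing_delta linearZ/= mulmxBr mulmxA -/(pairing_mx p f).
rewrite [pairing_mx p f *m (_ *m rho _)]mulmxA (pairing_sqr pf) mulNmx mul1mx.
rewrite opprK 2!mxE mul_pairing pairing_mul// => H.
apply: (etrans _ (etrans H _)); first by rewrite /r; ring.
rewrite [LHS]mxE [X in _ + X]mxE mul_pairing pairing_mul// !mxE /r.
ring.
Qed.

(** With p i = k, every term of entry (k, i) carries the factor f_i^2 except e r_iki. Comparing the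
    weights f_i and 2 f_i isolates that constant term; what remains is the second relation. *)
Lemma twist_coef_pair i k : i != k ->
  r i k i = 0 /\ e * r i i k = r k k k - r k i i.
Proof.
move=> ik; have [p [f [pf pik]]] := pairing_exists2 R ik.
have pki : p k = i by rewrite -pik; case: pf => ->.
have fi0 := pairing_neq0 i pf.
have t2 : 2 != 0 :> R by rewrite pnatr_eq0.
have := twist_coef i k i (pairing_scale i t2 pf).
have := twist_coef i k i pf.
rewrite !pik pki eqxx => h1 h2.
have e0 := twist_sign_neq0.
have h0 : r i k i = 0.
  have : 3 * e * r i k i = 0.
    transitivity (4 * (e * (f i * f i * r i i k + r i k i))
      - e * (2 * f i * (2 * f i) * r i i k + r i k i)); first by ring.
    by rewrite h1 h2; ring.
  by move=> /eqP; rewrite !mulf_eq0 (negPf e0) pnatr_eq0 => /eqP.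
split=> //; move: h1; rewrite h0 => h1.
have : f i * f i * (e * r i i k - (r k k k - r k i i)) = 0.
  rewrite mulrBr; apply/eqP; rewrite subr_eq0; apply/eqP.
  transitivity (e * (f i * f i * r i i k + 0)); first by ring.
  by rewrite h1; ring.
by move=> /eqP; rewrite !mulf_eq0 (negPf fi0) subr_eq0 => /eqP.
Qed.

(** With p i = j and p c = d, entry (d, c) has a quadratic and a constant term in f_c on the left
    and a linear one on the right. Adding the identities for the weights 2 f_c, f_c, - f_c with
    factors 1, -3/2, 1/2 leaves the quadratic term; subtracting those for f_c and - f_c leaves the
    linear one. The last relation is entry (j, c); its two hypotheses are instances of the first
    relation for other quadruples. *)
Lemma twist_coef_quad i j c d : uniq [:: i; j; c; d] ->
  [/\ r i c d = 0, r j d d = r j c c & r j i c = 0 -> r i j c = 0 ->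
     e * r i i d = r j j d].
Proof.
move=> u; have [p [f [pf pij pcd]]] := pairing_exists4 R u.
have pji : p j = i by rewrite -pij; case: pf => ->.
have pdc : p d = c by rewrite -pcd; case: pf => ->.
move: u; rewrite /= !inE !negb_or => /and4P[/and3P[ij ic id] /andP[jc jd] cd _].
have ci : (i == c) = false by exact: negPf.
have di : (i == d) = false by exact: negPf.
have fi0 := pairing_neq0 i pf; have fc0 := pairing_neq0 c pf.
have t2 : 2 != 0 :> R by rewrite pnatr_eq0.
have t1 : -1 != 0 :> R by rewrite oppr_eq0 oner_eq0.
have := twist_coef i d c pf.
have := twist_coef i d c (pairing_scale c t2 pf).
have := twist_coef i d c (pairing_scale c t1 pf).
rewrite !pij !pdc !pcd eqxx ci di => h3 h2 h1.
have e0 := twist_sign_neq0.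
have h0 : r i c d = 0.
  have : 3 * (e * (f c * f c)) * r i c d = 0.
    transitivity (e * (2 * f c * (2 * f c) * r i c d + r i d c)
      - 3/2 * (e * (f c * f c * r i c d + r i d c))
      + 1/2 * (e * (-1 * f c * (-1 * f c) * r i c d + r i d c))).
      by field.
    by rewrite h1 h2 h3; field.
  by move=> /eqP; rewrite !mulf_eq0 (negPf e0) (negPf fc0) pnatr_eq0 => /eqP.
have h4 : r j d d = r j c c.
  have : 2 * (f i * f c) * (r j d d - r j c c) = 0.
    transitivity (f i * (f c * r j d d - f c * r j c c)
       - f i * (-1 * f c * r j d d - -1 * f c * r j c c)); first by ring.
    by rewrite -h1 -h3; ring.
  move=> /eqP; rewrite !mulf_eq0 (negPf fi0) (negPf fc0) pnatr_eq0 subr_eq0.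
  by move=> /eqP.
split=> // h5 h6.
have := twist_coef i j c pf; rewrite pij pji pcd -/(r i j c) h5 h6 => h7.
have : f i * f c * (e * r i i d - r j j d) = 0.
  rewrite mulrBr; apply/eqP; rewrite subr_eq0; apply/eqP.
  transitivity (e * (f i * f c * r i i d + 0)); first by ring.
  by rewrite h7; ring.
by move=> /eqP; rewrite !mulf_eq0 (negPf fi0) (negPf fc0) subr_eq0 => /eqP.
Qed.

Lemma twist_coef_triple i j k : uniq [:: i; j; k] ->
  [/\ r i k j = 0, r i j j = r i k k & e * r i i k = r j j k].
Proof.
move=> u.
(* The dimension is even, so three distinct indices leave room for a fourth one. *)
have [l lijk] : exists l, l \notin [:: i; j; k].
  apply/existsP; apply: contraT => /existsPn all_in.
  have le1 : (size [:: i; j; k] <= size (enum 'I_(2 * q)))%N.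
    by apply: uniq_leq_size => // x _; rewrite mem_enum.
  have le2 : (size (enum 'I_(2 * q)) <= size [:: i; j; k])%N.
    apply: uniq_leq_size (enum_uniq _) _ => x _.
    by have := all_in x; rewrite negbK.
  by move: le1 le2; rewrite size_enum_ord /=; lia.
move: lijk u; rewrite !inE !negb_or /= !inE !negb_or => /and3P[li lj lk].
move=> /and3P[/andP[ij ik] jk _].
have ji : j != i by rewrite eq_sym.
have ki : k != i by rewrite eq_sym.
have kj : k != j by rewrite eq_sym.
have il : i != l by rewrite eq_sym.
have jl : j != l by rewrite eq_sym.
have kl : k != l by rewrite eq_sym.
have D := (ij, ji, ik, ki, jk, kj, il, li, jl, lj, kl, lk).
have q1 : uniq [:: i; l; k; j] by rewrite /= !inE !negb_or !D.
have q2 : uniq [:: l; i; k; j] by rewrite /= !inE !negb_or !D.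
have q3 : uniq [:: i; j; l; k] by rewrite /= !inE !negb_or !D.
have q4 : uniq [:: j; k; i; l] by rewrite /= !inE !negb_or !D.
have q5 : uniq [:: i; k; j; l] by rewrite /= !inE !negb_or !D.
have [h1 _ _] := twist_coef_quad q1.
have [_ h2 _] := twist_coef_quad q2.
have [_ _ h3] := twist_coef_quad q3.
have [h4 _ _] := twist_coef_quad q4.
have [h5 _ _] := twist_coef_quad q5.
by split=> //; exact: h3.
Qed.

End Coefficients.

(** The target form reads r_ikj = l_i [k = j] + u_j [k = i]. With n i any index other than i, it
    forces l_i = r_i,(n i),(n i) and u_i = r_(n i),(n i),i; the hypotheses say that these values do
    not depend on n i and that the remaining entries fit. *)
Lemma proportional_coefs m (rho : {linear 'cV[R]_m -> 'M[R]_m}) :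
  (2 <= m)%N ->
  (forall i k, i != k -> rho (delta_mx i 0) k i = 0 /\
     rho (delta_mx i 0) i k
     = rho (delta_mx k 0) k k - rho (delta_mx k 0) i i) ->
  (forall i j k, uniq [:: i; j; k] ->
     [/\ rho (delta_mx i 0) k j = 0,
         rho (delta_mx i 0) j j = rho (delta_mx i 0) k k &
         rho (delta_mx i 0) i k = rho (delta_mx j 0) j k]) ->
  exists l u : 'rV[R]_m, forall a, rho a = ((l *m a) 0 0)%:M + a *m u.
Proof.
move=> m2 h2 h3.
have nP (i : 'I_m) : exists j : 'I_m, j != i.
  case: m m2 i {rho h2 h3} => [//|[//|m _ i]].
  exists (if i == ord0 then lift ord0 ord0 else ord0).
  by case: (eqVneq i ord0) => [->|i0] //; rewrite eq_sym.
have [n nE] := choice nP.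
pose r i k j := rho (delta_mx i 0) k j.
exists (\row_i r i (n i) (n i)), (\row_i r (n i) (n i) i) => a.
suff H i : rho (delta_mx i 0) = (r i (n i) (n i))%:M
    + delta_mx i 0 *m \row_j r (n j) (n j) j.
  rewrite [a in LHS](matrix_sum_delta a) linear_sum.
  apply/matrixP => k j; rewrite summxE.
  under eq_bigr => i _ do rewrite big_ord1 linearZ/= H 2!mxE mulrDr.
  rewrite big_split /= 2!mxE; congr (_ + _).
    rewrite [in RHS]mxE -sumrMnl; apply: eq_bigr => i _.
    by rewrite !mxE mulrC mulrnAl.
  rewrite mxE big_ord1 mxE (bigD1 k)//= !mxE big_ord1 !mxE !eqxx mul1r.
  rewrite big1 ?addr0// => i ik.
  by rewrite !mxE big_ord1 !mxE (eq_sym k) (negPf ik) mul0r mulr0.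
apply/matrixP => k j; rewrite !mxE big_ord1 !mxE eqxx andbT -/(r i k j).
have [<-{j}|kj] := eqVneq k j.
  have [<-{k}|ki] := eqVneq i k.
    by rewrite mul1r mulr1n /r (h2 _ _ (nE i)).2 addrC subrK.
  rewrite mul0r addr0 mulr1n.
  have [->//|kn] := eqVneq k (n i).
  have u : uniq [:: i; k; n i].
    by rewrite /= !inE negb_or ki kn (eq_sym i (n i)) nE.
  by have [_ + _] := h3 _ _ _ u.
rewrite mulr0n add0r; have [ki|ki] := eqVneq k i.
  rewrite ki mul1r in kj *; have [->//|ni] := eqVneq (n j) i.
  have u : uniq [:: i; n j; j] by rewrite /= !inE negb_or nE (eq_sym i) ni kj.
  by have [_ _ +] := h3 _ _ _ u.
rewrite mul0r; have [<-|ij] := eqVneq i j.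
  by apply: (h2 _ _ _).1; rewrite eq_sym.
have u : uniq [:: i; j; k].
  by rewrite /= !inE negb_or ij (eq_sym i k) (eq_sym j k) kj ki.
by have [+ _ _] := h3 _ _ _ u.
Qed.

Lemma eq_mulmx_cV m n (A B : 'M[R]_(m, n)) :
  (forall b : 'cV_n, A *m b = B *m b) -> A = B.
Proof.
move=> AB; apply/matrixP => i j; have := AB (delta_mx j 0).
by rewrite -!colE => /colP/(_ i); rewrite !mxE.
Qed.

(** The lambda part is scalar and drops out of the commutators; both sides then send b to mu(Jb) Ja
    + mu(b) a. As [lambda] and [mu] are plain functions, the coefficients of the curvature condition
    can be inserted directly. *)
Lemma twist_cond_proportional m (rho : 'cV[R]_m -> 'M[R]_m)
    (lambda mu : 'cV[R]_m -> R) :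
  (forall a b, rho a *m b = lambda a *: b + mu b *: a) -> twist_cond 1 rho.
Proof.
move=> rhoE J a JJ; rewrite scale1r; apply: eq_mulmx_cV => b.
rewrite mulmxBl -mulmxA mulmxBl -!mulmxA !rhoE !(mulmxN, mulmxDr).
rewrite -!scalemxAr !mulmxA JJ.
rewrite !mulNmx !mul1mx; move: (J *m a) (J *m b) => a1 b1.
by apply/colP => k; rewrite !mxE; ring.
Qed.

Lemma twist_cond_scalar m e (rho : 'cV[R]_m -> 'M[R]_m)
    (alpha : 'cV[R]_m -> R) :
  (forall a (b : 'cV_m), rho a *m b = alpha a *: b) -> twist_cond e rho.
Proof.
move=> rhoE J a JJ.
have {}rhoE (c : 'cV[R]_m) : rho c = (alpha c)%:M.
  by apply: eq_mulmx_cV => b; rewrite rhoE mul_scalar_mx.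
by rewrite !rhoE !scalar_mxC !subrr mulmx0 scaler0.
Qed.

Lemma twist_cond1_form q (rho : {linear 'cV[R]_(2 * q) -> 'M[R]_(2 * q)}) :
  (1 <= q)%N -> twist_cond 1 rho ->
  exists l u : 'rV[R]_(2 * q), forall a, rho a = ((l *m a) 0 0)%:M + a *m u.
Proof.
move=> q1 rhoP; have e2 : 1 * 1 = 1 :> R by rewrite mulr1.
apply: proportional_coefs => [|i k ik|i j k u]; first by lia.
  by have := twist_coef_pair e2 rhoP ik; rewrite mul1r.
by have := twist_coef_triple e2 rhoP u; rewrite mul1r.
Qed.

(** Polarization in the plane: e_i + t e_k is an eigenvector of its own image under rho. Eliminating
    the eigenvalue gives an identity in t whose t^2 coefficient, isolated by t = 1 and t = -1, is
    the required relation. No three distinct indices exist. *)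
Lemma diag_proportional_form m (rho : {linear 'cV[R]_m -> 'M[R]_m})
    (nu : 'cV[R]_m -> R) : m = 2 ->
  (forall a, rho a *m a = nu a *: a) ->
  exists l u : 'rV[R]_m, forall a, rho a = ((l *m a) 0 0)%:M + a *m u.
Proof.
move=> m2 rhoP; pose r i k j := rho (delta_mx i 0) k j.
have r0 i k : i != k -> r i k i = 0.
  move=> ik; have /colP/(_ k) := rhoP (delta_mx i 0).
  by rewrite -colE !mxE (eq_sym k) (negPf ik) mulr0.
apply: proportional_coefs; first by rewrite m2.
  move=> i k ik; split; first exact: r0.
  have ki : k != i by rewrite eq_sym.
  have rP (t : R) : t * (r i i i + t * r i i k + t * r k i i)
      = t * r i k k + t * r k k i + t * t * r k k k.
    have := rhoP (delta_mx i 0 + t *: delta_mx k 0).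
    rewrite [rho (_ + _)]linearD [rho (_ *: _)]linearZ/= mulmxDl !mulmxDr.
    rewrite -!scalemxAl -!scalemxAr -!colE.
    move=> /colP H; have := H i; have := H k.
    rewrite !mxE !eqxx (negPf ik) (negPf ki) /= -!/(r _ _ _).
    rewrite (r0 _ _ ik) (r0 _ _ ki) !mulr0 !addr0 add0r mulr1 => H1 H2.
    rewrite H2.
    transitivity (t * r i k k + (t * r k k i + t * (t * r k k k))).
      by rewrite H1; ring.
    by ring.
  by have := rP 1; have := rP (-1); rewrite -!/(r _ _ _); lra.
move=> i j k u; exfalso.
have : (size [:: i; j; k] <= size (enum 'I_m))%N.
  by apply: uniq_leq_size => // x _; rewrite mem_enum.
by rewrite size_enum_ord /=; lia.
Qed.

(** The condition is invariant under GL because g J h is again a complex structure. *)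
Lemma twist_cond_conj m e (rho : {linear 'cV[R]_m -> 'M[R]_m}) (g h : 'M[R]_m) :
  g *m h = 1%:M -> h *m g = 1%:M -> twist_cond e rho ->
  twist_cond e (fun a => h *m rho (g *m a) *m g).
Proof.
move=> gh hg rhoP J a JJ.
have J'2 : (g *m J *m h) *m (g *m J *m h) = - 1%:M.
  by rewrite !mulmxA -[X in X *m _ *m _]mulmxA hg mulmx1 -[X in X *m _]mulmxA
    JJ mulmxN mulmx1 mulNmx gh.
have := rhoP _ (g *m a) J'2 => /(congr1 (fun M => h *m M *m g)).
have -> : g *m J *m h *m (g *m a) = g *m (J *m a).
  by rewrite !mulmxA -[X in X *m _]mulmxA hg mulmx1.
rewrite -scalemxAr -scalemxAl => H.
have cK (X : 'M[R]_m) : h *m (g *m J *m h *m X) *m g = J *m (h *m X *m g).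
  by rewrite !mulmxA hg mul1mx.
have cKr (X : 'M[R]_m) : h *m (X *m (g *m J *m h)) *m g = h *m X *m g *m J.
  by rewrite !mulmxA -[X in X = _]mulmxA hg mulmx1.
rewrite cK mulmxBr mulmxBl cKr cK in H.
by rewrite H mulmxBr mulmxBl cKr cK.
Qed.

Lemma twist_condN1_scalar q (rho : {linear 'cV[R]_(2 * q) -> 'M[R]_(2 * q)}) :
  twist_cond (-1) rho ->
  exists l : 'rV[R]_(2 * q), forall a, rho a = ((l *m a) 0 0)%:M.
Proof.
move=> rhoP; have e2 : -1 * -1 = 1 :> R by ring.
pose r i k j := rho (delta_mx i 0) k j.
have pairE i k : i != k -> r i k i = 0 /\ - r i i k = r k k k - r k i i.
  by move=> ik; have := twist_coef_pair e2 rhoP ik; rewrite mulN1r.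
(* Conjugating by g = 1 + t E_jk preserves the condition on rho. *)
have shear t k j : j != k -> t * (r k j j + r j j k - r k k k) =
    t * t * (r k k j + r j k k - r j j j).
  move=> jk; pose g s : 'M[R]_(2 * q) := 1%:M + s *: delta_mx j k.
  have gE s : g s = 1%:M + s *: delta_mx j k by [].
  have gg s : g s *m g (- s) = 1%:M.
    rewrite !(mulmxDl, mulmxDr, mul1mx, mulmx1) -!scalemxAl -!scalemxAr.
    rewrite mul_delta_mx_cond (eq_sym k) (negPf jk) mulr0n !scaler0 addr0.
    by rewrite !gE scaleNr subrK.
  have gN s : g (- s) *m g s = 1%:M by rewrite -{2}[s]opprK gg.
  pose rho' (a : 'cV[R]_(2 * q)) := g (- t) *m rho (g t *m a) *m g t.
  have rhoL : linear rho'.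
    rewrite /rho' => s x y; move: (g t) (g (- t)) => g1 g2.
    rewrite [g1 *m (_ + _)]mulmxDr -scalemxAr [rho (_ + _)]linearP.
    by rewrite mulmxDr mulmxDl -scalemxAr -scalemxAl.
  pose rM := GRing.isLinear.Build R 'cV[R]_(2 * q) 'M[R]_(2 * q) *:%R rho' rhoL.
  pose rL : {linear 'cV[R]_(2 * q) -> 'M[R]_(2 * q)} := HB.pack rho' rM.
  have rLP : twist_cond (-1) rL by exact: twist_cond_conj (gg t) (gN t) rhoP.
  have kj : k != j by rewrite eq_sym.
  have gk : g t *m delta_mx k 0 = delta_mx k 0 + t *: delta_mx j 0
      :> 'cV[R]_(2 * q).
    by rewrite gE mulmxDl mul1mx -scalemxAl mul_delta_mx.
  have gl s (X : 'M[R]_(2 * q)) b : (g s *m X) j b = X j b + s * X k b.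
    rewrite gE mulmxDl mul1mx -scalemxAl !mxE (bigD1 k)//= !mxE !eqxx mul1r.
    by rewrite big1 ?addr0// => i ik; rewrite !mxE (negPf ik) andbF mul0r.
  have gr s (X : 'M[R]_(2 * q)) b : (X *m g s) b k = X b k + s * X b j.
    rewrite gE mulmxDr mulmx1 -scalemxAr !mxE (bigD1 j)//= !mxE !eqxx mulr1.
    by rewrite big1 ?addr0// => i ij; rewrite !mxE (negPf ij) mulr0.
  (* Entry (j, k) of the transformed rho at e_k must vanish; expanding it in t gives the
     relation. *)
  have [+ _] := twist_coef_pair e2 rLP kj.
  rewrite /= /rho' gr !gl gk [rho (_ + _)]linearD [rho (_ *: _)]linearZ !mxE.
  rewrite -!/(r _ _ _).
  rewrite (pairE _ _ kj).1 (pairE _ _ jk).1 => H.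
  apply/eqP; rewrite -subr_eq0; apply/eqP; rewrite -{}H; ring.
(* Taking t = 1 and t = -1 kills the coefficient of t. By the pair relation with e = -1 this
   coefficient is 2 r_iik, whereas with e = 1 it would vanish identically. *)
have r0 i k : i != k -> r i i k = 0 /\ r k k k = r k i i.
  move=> ik; have [_ h1] := pairE _ _ ik.
  by have := shear 1 k i ik; have := shear (-1) k i ik; lra.
exists (\row_i r i i i) => a.
suff H i : rho (delta_mx i 0) = (r i i i)%:M.
  rewrite [a in LHS](matrix_sum_delta a) linear_sum.
  apply/matrixP => k j; rewrite summxE.
  under eq_bigr => i _ do rewrite big_ord1 linearZ/= H 2!mxE.
  rewrite [in RHS]mxE mxE -sumrMnl; apply: eq_bigr => i _.
  by rewrite !mxE mulrC mulrnAl.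
apply/matrixP => k j; rewrite !mxE -/(r i k j).
have [<-{j}|kj] := eqVneq k j.
  have [->//|ki] := eqVneq k i.
  by rewrite mulr1n (r0 _ _ ki).2.
rewrite mulr0n; have [ij|ij] := eqVneq i j.
  by rewrite -ij in kj *; apply: (pairE _ _ _).1; rewrite eq_sym.
have [->|ik] := eqVneq k i; first by apply: (r0 _ _ ij).1.
have u : uniq [:: i; j; k].
  by rewrite /= !inE negb_or ij (eq_sym i k) (eq_sym j k) kj ik.
by have [+ _ _] := twist_coef_triple e2 rhoP u.
Qed.

End TwistCondition.
(** * Foliated charts *)

Section Chart.
Variables (R : realType) (M : topologicalType) (p m : nat).
Variables (F : foliated_atlas R M p m) (nabla : connection F).
Hypothesis nabla_adapted : adapted nabla.

Lemma in_F_col_mx (a : 'cV[R]_p) : in_F (col_mx a (0 : 'cV[R]_m)).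
Proof. by rewrite /in_F col_mxKd. Qed.

Lemma lift_NK (w : 'cV[R]_m) : dsubmx (lift_N p w) = w.
Proof. exact: col_mxKd. Qed.

Lemma lift_N_linear : linear (@lift_N R p m).
Proof.
by move=> a u v; rewrite /lift_N scale_col_mx add_col_mx scaler0 addr0.
Qed.

Lemma fol_img_nbhs (i : fol_idx F) u : fol_img i u -> nbhs u (fol_img i).
Proof.
by move=> Uu; apply: open_nbhs_nbhs; split=> //; exact: fol_img_open.
Qed.

Lemma bracket_cst (E : normedModType R) (X Y : E) u :
  bracket (cst X) (cst Y) u = 0.
Proof. by rewrite /bracket !derive_cst subrr. Qed.

Lemma conn_form_in_F (i : fol_idx F) u Y :
  fol_img i u -> in_F Y -> conn_form nabla i u Y = 0.
Proof.
move=> Uu FY; apply: eq_mulmx_cV => w; rewrite mul0mx.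
have oU := @fol_img_open _ _ _ _ F i.
have := @nabla_adapted i (fol_img i) (cst (lift_N p w)) (cst Y) oU
  (@subset_refl _ _) (smooth_on_cst oU _) (smooth_on_cst oU _) (fun _ _ => FY)
  u Uu.
by rewrite bracket_cst /cov /cst lift_NK derive_cst add0r raddf0.
Qed.

Lemma conn_form_lift (i : fol_idx F) u X : fol_img i u ->
  conn_form nabla i u X = conn_form nabla i u (lift_N p (dsubmx X)).
Proof.
move=> Uu; have Hl := conn_linear nabla Uu.
transitivity (conn_form nabla i u
    (1 *: col_mx (usubmx X) 0 + lift_N p (dsubmx X))).
  by rewrite scale1r add_col_mx addr0 add0r vsubmxK.
by rewrite Hl (conn_form_in_F Uu (in_F_col_mx _)) scaler0 add0r.
Qed.

(* For y in F this is minus the curvature R(a, y), see [riemE]. *)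
Definition dconn (i : fol_idx F) u (y : 'cV[R]_(p + m)) (a : 'cV[R]_m) :
    'M[R]_m :=
  'D_y (fun u => conn_form nabla i u (lift_N p a)) u.

Lemma conn_form_derivable (i : fol_idx F) u y X : fol_img i u ->
  derivable (fun u => conn_form nabla i u X) u y.
Proof.
move=> Uu; apply: diff_derivable.
exact: (@conn_smooth _ _ _ _ _ nabla i X [::] u).
Qed.

Lemma dconn_linear (i : fol_idx F) u y : fol_img i u -> linear (dconn i u y).
Proof.
move=> Uu s a b; rewrite /dconn.
have dC X : derivable (fun u => conn_form nabla i u X) u y.
  exact: conn_form_derivable.
rewrite -deriveZ// -deriveD//; last exact: derivableZ.
apply: near_eq_derive; apply: filterS (fol_img_nbhs Uu) => v Uv.
by rewrite lift_N_linear (conn_linear nabla Uv).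
Qed.

Lemma cov_in_F (i : fol_idx F) Y (w : 'cV[R]_m) u : fol_img i u -> in_F Y ->
  cov nabla i (cst Y) (cst w) u = 0.
Proof.
by move=> Uu FY; rewrite /cov derive_cst add0r conn_form_in_F// mul0mx.
Qed.

Lemma derive_near0 (E W : normedModType R) (f : E -> W) u v :
  (\forall v \near u, f v = 0) -> 'D_v f u = 0.
Proof.
move=> f0; rewrite -(derive_cst (0 : W) u v); apply: near_eq_derive.
exact: f0.
Qed.

Lemma cov_near0 (i : fol_idx F) X s u :
  (\forall v \near u, s v = 0) -> cov nabla i X s u = 0.
Proof.
move=> s0; rewrite /cov derive_near0// (nbhs_singleton s0) mulmx0 addr0//.
Qed.

Lemma is_derive_mulmx_cst (E : normedModType R) k l n (f : E -> 'M[R]_(k, l))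
    (B : 'M[R]_(l, n)) u v :
  derivable f u v -> is_derive u v (fun u => f u *m B) ('D_v f u *m B).
Proof.
move=> /derivableP df.
have Ll : linear (mulmxr B : 'M[R]_(k, l) -> _).
  by move=> a x y; rewrite linearP.
exact: is_derive_lin Ll (continuous_mx_lin Ll) df.
Qed.

Lemma riemE (i : fol_idx F) x X Y w : fol_dom i x -> in_F Y ->
  riem nabla i x X Y w = - (dconn i (fol_phi i x) Y (dsubmx X) *m w).
Proof.
move=> dx FY; have Ux : fol_img i (fol_phi i x) by exists x.
rewrite /riem /curv; set u := fol_phi i x in Ux *.
(* Constant sections are parallel along F on the whole chart, so the term nabla_X nabla_Y w
   vanishes. *)
rewrite [cov _ _ (cst X) _ _]cov_near0; last first.
  by apply: filterS (fol_img_nbhs Ux) => v Uv; exact: cov_in_F.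
rewrite [cov nabla i (bracket _ _) _ _]/cov bracket_cst derive0.
rewrite conn_form_in_F//; last by rewrite /in_F raddf0.
rewrite mul0mx addr0 subr0 sub0r [in LHS]/cov conn_form_in_F// mul0mx addr0.
congr (- _); rewrite /dconn.
have [_ <-] := is_derive_mulmx_cst w
  (@conn_form_derivable i _ Y (lift_N p (dsubmx X)) Ux).
apply: near_eq_derive; apply: filterS (fol_img_nbhs Ux) => v Uv.
by rewrite derive_cst add0r conn_form_lift.
Qed.

Lemma tors_NE (i : fol_idx F) (s t : 'cV[R]_m) u :
  tors_N nabla i (cst s) (cst t) u =
  conn_form nabla i u (lift_N p s) *m t - conn_form nabla i u (lift_N p t) *m s.
Proof.
rewrite -[LHS]/(tors nabla i (cst (lift_N p s)) (cst (lift_N p t)) u) /tors.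
by rewrite bracket_cst raddf0 subr0 /cov /cst !lift_NK !derive_cst !add0r.
Qed.

Lemma bracket_near0 (E : normedModType R) (X Y : E -> E) u :
  (\forall v \near u, X v = 0) -> bracket X Y u = 0 /\ bracket Y X u = 0.
Proof.
move=> X0; rewrite /bracket (nbhs_singleton X0) derive0.
by rewrite !(derive_near0 _ X0) subrr.
Qed.

Lemma near_lift0 (s : 'cV[R]_(p + m) -> 'cV[R]_m) (u : 'cV[R]_(p + m)) :
  (\forall v \near u, s v = 0) -> \forall v \near u, lift_N p (s v) = 0.
Proof. by apply: filterS => v ->; rewrite /lift_N col_mx0. Qed.

Lemma tors_N_near0 (i : fol_idx F) (s t : 'cV[R]_(p + m) -> 'cV[R]_m)
    (u : 'cV[R]_(p + m)) :
  fol_img i u -> (\forall v \near u, s v = 0) ->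
  tors_N nabla i s t u = 0 /\ tors_N nabla i t s u = 0.
Proof.
move=> Uu s0; have ls0 := near_lift0 s0.
have dsE : (fun v => dsubmx (lift_N p (s v))) = s.
  by apply/funext => v; rewrite lift_NK.
rewrite /tors_N /tors.
have [-> ->] := bracket_near0 (fun v => lift_N p (t v)) ls0.
rewrite dsE !(cov_near0 _ _ s0) [dsubmx 0]raddf0 !subr0 sub0r.
rewrite /cov (nbhs_singleton ls0) derive0 conn_form_in_F//; last first.
  by rewrite /in_F raddf0.
by rewrite mul0mx addr0 oppr0.
Qed.

(** Constant sections are parallel along Y, so only the derivative of T(s,t) = Gamma(s) t - Gamma(t)
    s survives. *)
Lemma nabla_torsE (i : fol_idx F) x X Y Z : fol_dom i x -> in_F Y ->
  nabla_tors nabla i x Y X Z =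
  dconn i (fol_phi i x) Y (dsubmx X) *m dsubmx Z
  - dconn i (fol_phi i x) Y (dsubmx Z) *m dsubmx X.
Proof.
move=> dx FY; have Ux : fol_img i (fol_phi i x) by exists x.
rewrite /nabla_tors /cov_tors_N; set u := fol_phi i x in Ux *.
have cov0 w : \forall v \near u, cov nabla i (cst Y) (cst w) v = 0.
  by apply: filterS (fol_img_nbhs Ux) => v Uv; exact: cov_in_F.
rewrite (tors_N_near0 _ Ux (cov0 _)).1 (tors_N_near0 _ Ux (cov0 _)).2 !subr0.
rewrite /cov conn_form_in_F// mul0mx addr0 /dconn.
have dC a w := is_derive_mulmx_cst (w : 'cV[R]_m)
  (@conn_form_derivable i _ Y (lift_N p a) Ux).
have [_ <-] := is_deriveB (dC (dsubmx X) (dsubmx Z)) (dC (dsubmx Z) (dsubmx X)).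
congr ('D_Y _ u); apply/funext => v; exact: tors_NE.
Qed.

Lemma tr_riemE (i : fol_idx F) x X Y : fol_dom i x -> in_F Y ->
  tr_riem nabla i x X Y = - \tr (dconn i (fol_phi i x) Y (dsubmx X)).
Proof.
move=> dx FY; rewrite /tr_riem /tr_end /mxtrace -sumrN; apply: eq_bigr => a _.
by rewrite riemE// -colE !mxE.
Qed.

Lemma ricE (i : fol_idx F) x X Y : fol_dom i x -> in_F Y ->
  ric nabla i x Y X = - \sum_a
     (dconn i (fol_phi i x) Y (delta_mx a 0) *m dsubmx X) a 0.
Proof.
move=> dx FY; rewrite /ric /tr_end -sumrN; apply: eq_bigr => a _.
by rewrite riemE// lift_NK mxE.
Qed.

(** The trace of the first Bianchi identity. It converts the Ricci form of each coefficient into its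
    torsion form and fixes the sign of the torsion term. *)
Lemma tr_nabla_torsE (i : fol_idx F) x X Y : fol_dom i x -> in_F Y ->
  tr_nabla_tors nabla i x X Y = ric nabla i x Y X - tr_riem nabla i x X Y.
Proof.
move=> dx FY; rewrite ricE// tr_riemE// opprK addrC /tr_nabla_tors /tr_end.
rewrite /mxtrace -sumrB; apply: eq_bigr => a _.
by rewrite nabla_torsE// lift_NK mxE -colE !mxE.
Qed.

End Chart.

(** * Foliated vector fields on the twistor space *)

Section TwistorSpace.
Variables (R : realType) (M : topologicalType) (p m : nat).
Variables (F : foliated_atlas R M p m) (nabla : connection F).
Hypothesis nabla_adapted : adapted nabla.

Local Notation B := 'cV[R]_(p + m).
Local Notation T := ('cV[R]_(p + m) * 'M[R]_m)%type.

Lemma in_hatFE (i : fol_idx F) (z t : T) : fol_img i z.1 ->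
  in_hatF nabla i z t <-> in_F t.1 /\ t.2 = 0.
Proof.
rewrite /in_hatF /vert => Uz; split=> -[Ft H]; split=> //; move: H;
  by rewrite conn_form_in_F// mul0mx mulmx0 subr0 addr0.
Qed.

Lemma hatFB (s t : T) : in_F s.1 -> s.2 = 0 -> in_F t.1 -> t.2 = 0 ->
  in_F (s - t).1 /\ (s - t).2 = 0.
Proof.
rewrite /in_F => s1 s2 t1 t2; split; last by rewrite /= s2 t2 subr0.
have -> : dsubmx (s - t).1 = dsubmx s.1 - dsubmx t.1 by exact: raddfB.
by rewrite s1 t1 subr0.
Qed.

Lemma derive_fst (E V W : normedModType R) (f : E -> V * W) x v :
  differentiable f x -> 'D_v (fun z => (f z).1) x = ('D_v f x).1.
Proof.
move=> /(@diff_derivable _ _ _ _ _ v)/derivableP df.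
by have [_] := is_derive_linear (L := fst) (@fst_cont R V W) df.
Qed.

Lemma derive_snd (E V W : normedModType R) (f : E -> V * W) x v :
  differentiable f x -> 'D_v (fun z => (f z).2) x = ('D_v f x).2.
Proof.
move=> /(@diff_derivable _ _ _ _ _ v)/derivableP df.
by have [_] := is_derive_linear (L := snd) (@snd_cont R V W) df.
Qed.

Lemma differentiable_fst (E V W : normedModType R) (f : E -> V * W) x :
  differentiable f x -> differentiable (fun z => (f z).1) x.
Proof.
move=> df; apply: (@differentiable_comp _ _ _ _ f fst) => //.
by apply: linear_differentiable; exact: fst_cont.
Qed.

Lemma differentiable_snd (E V W : normedModType R) (f : E -> V * W) x :
  differentiable f x -> differentiable (fun z => (f z).2) x.
Proof.
move=> df; apply: (@differentiable_comp _ _ _ _ f snd) => //.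
by apply: linear_differentiable; exact: snd_cont.
Qed.

Lemma derive_mx_linear (E W : normedModType R) k l
    (L : {linear 'M[R]_(k, l) -> W}) (f : E -> 'M[R]_(k, l)) x v :
  differentiable f x -> 'D_v (fun z => L (f z)) x = L ('D_v f x).
Proof.
move=> /(@diff_derivable _ _ _ _ _ v)/derivableP df.
have Ll : linear L by exact: linearP.
by have [_] := is_derive_lin Ll (continuous_mx_lin Ll) df.
Qed.

Lemma differentiable_mx_linear (E W : normedModType R) k l
    (L : {linear 'M[R]_(k, l) -> W}) (f : E -> 'M[R]_(k, l)) x :
  differentiable f x -> differentiable (fun z => L (f z)) x.
Proof.
move=> df; apply: (@differentiable_comp _ _ _ _ f L) => //.
by apply: linear_differentiable; exact: continuous_mx_lin (@linearP _ _ _ _ L).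
Qed.

(** One direction tests the constant fields (y, 0). In the other, the bracket has two terms: the
    derivative of Y along X has no transverse part, as the transverse part of Y vanishes on the
    twistor space and X is tangent to it; the derivative of X along Y is covered by the
    hypothesis. *)
Lemma foliated_vfieldE (i : fol_idx F) O X : open O -> twistor_vfield i O X ->
  foliated_vfield nabla i O X <->
  forall z y, O z -> twistor i z -> in_F y ->
    in_F ('D_((y, 0) : T) X z).1 /\ ('D_((y, 0) : T) X z).2 = 0.
Proof.
move=> oO tX; have [sX tgX] := tX; split.
  move=> [_ fX] z y Oz tz Fy.
  have tY : twistor_vfield i O (cst ((y, 0) : T)).
    split=> [|z' _ _]; first exact: smooth_on_cst.
    by rewrite /= mul0mx mulmx0 addr0.
  have FYc z' : O z' -> twistor i z' ->
      in_hatF nabla i z' (cst ((y, 0) : T) z').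
    by move=> _ [Uz' _]; apply/in_hatFE.
  have := fX O _ oO (@subset_refl _ _) tY FYc z Oz tz.
  move=> /(in_hatFE _ (proj1 tz)); rewrite /bracket derive_cst sub0r /=.
  by rewrite /in_F raddfN => -[/eqP + /eqP]; rewrite !oppr_eq0 => /eqP ? /eqP.
move=> hX; split=> // O' Y oO' O'O [sY tgY] FY z O'z tz.
have Uz : fol_img i z.1 by case: tz.
have dY : differentiable Y z by exact: (sY [::]).
have FY' z' : O' z' -> twistor i z' -> in_F (Y z').1 /\ (Y z').2 = 0.
  by move=> O'z' tz'; apply/in_hatFE; [case: tz'|exact: FY].
have tgz : (X z).2 *m z.2 + z.2 *m (X z).2 = 0 by apply: tgX => //; exact: O'O.
have oU := @fol_img_open _ _ _ _ F i.
apply/in_hatFE => //; rewrite /bracket.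
have [h1 h2] := FY' _ O'z tz.
have YE : Y z = ((Y z).1, 0) by rewrite -h2; case: (Y z).
have [h3 h4] := hX _ _ (O'O _ O'z) tz h1.
rewrite YE.
have := @hatFB ('D_(X z) Y z) ('D_(((Y z).1, 0) : T) X z) _ _ h3 h4.
apply.
  rewrite /in_F -derive_fst// -derive_mx_linear; last exact: differentiable_fst.
  apply: (derive_tangent_eq0 oU oO' _ Uz O'z _ tgz).
  - exact/differentiable_mx_linear/differentiable_fst.
  - by case: tz.
  - by move=> z' O'z' Uz' JJ; apply: (FY' z' O'z' _).1; split.
rewrite -derive_snd//.
apply: (derive_tangent_eq0 oU oO' _ Uz O'z _ tgz).
- exact: differentiable_snd.
- by case: tz.
- by move=> z' O'z' Uz' JJ; apply: (FY' z' O'z' _).2; split.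
Qed.

End TwistorSpace.

(** * Matrix-valued derivatives and commutators *)

Section DeriveMatrix.
Variables (R : realType) (E : normedModType R) (x v : E).

Lemma is_derive_mx k l (A : E -> 'M[R]_(k, l)) (dA : 'M[R]_(k, l)) :
  (forall i j, is_derive x v (fun y => A y i j) (dA i j)) -> is_derive x v A dA.
Proof.
move=> dAij.
have AE : A = \sum_(i < k) \sum_(j < l) (fun y => A y i j *: delta_mx i j).
  apply/funext => y; rewrite [LHS]matrix_sum_delta fct_sumE.
  by apply: eq_bigr => i _; rewrite fct_sumE.
rewrite AE [dA]matrix_sum_delta; apply: is_derive_sum => i.
apply: is_derive_sum => j.
apply: (is_derive_lin
  (L := fun t : R => t *: (delta_mx i j : 'M[R]_(k, l)))) => //.
  by move=> a s t; rewrite scalerDl scalerA.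
exact: scalel_continuous.
Qed.

Lemma is_derive_scale k l (f : E -> R) (g : E -> 'M[R]_(k, l)) df dg :
  is_derive x v f df -> is_derive x v g dg ->
  is_derive x v (fun y => f y *: g y) (df *: g x + f x *: dg).
Proof.
move=> Df Dg; apply: is_derive_mx => i j.
have Dgij : is_derive x v (fun y => g y i j) (dg i j).
  have Ll : linear (fun A : 'M[R]_(k, l) => A i j).
    by move=> a B C; rewrite !mxE.
  exact: is_derive_lin Ll (continuous_mx_lin Ll) Dg.
rewrite (_ : (fun y => _) = f * (fun y => g y i j)); last first.
  by apply/funext => y; rewrite mxE.
by apply: is_derive_eq; rewrite !mxE addrC [_ *: df]mulrC.
Qed.

End DeriveMatrix.

Section Commutator.
Variables (R : realType) (m : nat).
Implicit Types J A B : 'M[R]_m.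

Definition ad J A := A *m J - J *m A.

Lemma ad_linear J : linear (ad J).
Proof.
move=> a A B; rewrite /ad mulmxDl mulmxDr -scalemxAl -scalemxAr scalerBr opprD.
by rewrite addrACA.
Qed.

Lemma ad_anticomm J A : J *m J = - 1%:M -> ad J A *m J + J *m ad J A = 0.
Proof.
move=> JJ; rewrite /ad mulmxBl mulmxBr -[A *m J *m J]mulmxA JJ.
rewrite [J *m (J *m A)]mulmxA JJ.
by rewrite mulmxN mulNmx mulmx1 mul1mx opprK mulmxA addrA subrK addNr.
Qed.

(** Tangency of the lift of the transformed section. V + [A, J] is the vertical part of the original
    class; subtracting [C, J] returns from vertical parts to chart components. *)
Lemma anticomm_twist (e : R) J V A C : J *m J = - 1%:M ->
  V *m J + J *m V = 0 ->
  (e *: (J *m (V + ad J A)) - ad J C) *m J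
    + J *m (e *: (J *m (V + ad J A)) - ad J C) = 0.
Proof.
move=> JJ VJ.
have : (V + ad J A) *m J + J *m (V + ad J A) = 0.
  by rewrite mulmxDl mulmxDr addrACA VJ ad_anticomm// addr0.
move: (V + _) => W WJ.
rewrite mulmxBl mulmxBr addrACA -opprD ad_anticomm// oppr0 addr0.
by rewrite -scalemxAl -scalemxAr -scalerDr -mulmxA -mulmxDr WJ mulmx0 scaler0.
Qed.

Lemma is_derive_twist (E : normedModType R) (x v : E) (e : R) J
    (W C D : E -> 'M[R]_m) dW dC dD :
  is_derive x v W dW -> is_derive x v C dC -> is_derive x v D dD ->
  is_derive x v (fun y => e *: (J *m (W y + ad J (C y))) - ad J (D y))
    (e *: (J *m (dW + ad J dC)) - ad J dD).
Proof.
move=> Dw Dc Dd.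
have Lad := ad_linear J.
have LJ : linear (fun A => e *: (J *m A)).
  by move=> a A B; rewrite mulmxDr -scalemxAr scalerDr !scalerA mulrC.
apply: is_deriveB; last exact: is_derive_lin Lad (continuous_mx_lin Lad) Dd.
apply: is_derive_lin LJ (continuous_mx_lin LJ) _; apply: is_deriveD.
exact: is_derive_lin Lad (continuous_mx_lin Lad) Dc.
Qed.

End Commutator.

(** * Projectability as a condition on the connection matrices *)

Lemma derive_comp_fst (R : realType) (E V W : normedModType R) (h : E -> W)
    (z v : E * V) : 'D_v (fun z => h z.1) z = 'D_(v.1) h z.1.
Proof. by []. Qed.

Section Projectable.
Variables (R : realType) (M : topologicalType) (p m : nat).
Variables (F : foliated_atlas R M p m) (nabla : connection F).
Hypothesis nabla_adapted : adapted nabla.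
Variables (e : R) (I : 'M[R]_m -> 'cV[R]_m * 'M[R]_m -> 'cV[R]_m * 'M[R]_m).
Hypothesis IE : forall J t, I J t = (J *m t.1, e *: (J *m t.2)).

Local Notation T := ('cV[R]_(p + m) * 'M[R]_m)%type.

Lemma pi_hatNE (i : fol_idx F) (z t : T) : fol_img i z.1 ->
  pi_hatN nabla i z t =
  (dsubmx t.1, t.2 + ad z.2 (conn_form nabla i z.1 (lift_N p (dsubmx t.1)))).
Proof.
move=> Uz; rewrite /pi_hatN /vert /ad (conn_form_lift nabla_adapted _ Uz).
by rewrite addrA.
Qed.

Lemma foliated_cst (i : fol_idx F) (w : 'cV[R]_m) :
  foliated_vfield nabla i setT (cst ((lift_N p w, 0) : T)).
Proof.
apply/foliated_vfieldE => //; first exact: openT.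
  split=> [|z _ _]; first by apply: smooth_on_cst; exact: openT.
  by rewrite /= mul0mx mulmx0 addr0.
by move=> z y _ _ _; rewrite derive_cst /in_F /= raddf0.
Qed.

Lemma near_line_setI (W : normedModType R) (f g : T -> W) (O : set T)
    (i : fol_idx F) u J y :
  open O -> O (u, J) -> fol_img i u -> J *m J = - 1%:M ->
  (forall v, O (v, J) -> fol_img i v -> f (v, J) = g (v, J)) ->
  'D_((y, 0) : T) f (u, J) = 'D_((y, 0) : T) g (u, J).
Proof.
move=> oO Ou Uu JJ fg; apply: near_line_derive.
have cc : t *: ((y, 0) : T) @[t --> (0 : R)] --> (0 : R) *: ((y, 0) : T).
  exact: (@scalel_continuous R T (y, 0) 0).
have {}cc : (t *: ((y, 0) : T) + (u, J)) @[t --> (0 : R)] --> ((u, J) : T).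
  have := cvgD cc (cvg_cst ((u, J) : T)); rewrite scale0r add0r; exact.
have nO : nbhs ((u, J) : T) (O `&` fst @^-1` fol_img i).
  apply: open_nbhs_nbhs; split=> //; apply: openI => //.
  by apply: open_comp; [move=> z _; exact: cvg_fst|exact: fol_img_open].
have : \forall t \near (0 : R),
    (O `&` fst @^-1` fol_img i) (t *: ((y, 0) : T) + (u, J)).
  exact: cc _ nO.
apply: filterS => t.
have -> : t *: ((y, 0) : T) + (u, J) = (t *: y + u, J).
  by congr pair; rewrite /= scaler0 add0r.
by move=> [Ot Ut]; exact: fg.
Qed.

(** The test section is the class of the constant field (lift a, 0). Any lift of its image under I
    has matrix component e J [Gamma(a), J] - [Gamma(Ja), J]; foliatedness makes the derivative of
    this along y in F vanish, which is the condition. *)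
Lemma projectable_twist_cond : projectable nabla I ->
  forall (i : fol_idx F) u y, fol_img i u -> in_F y ->
  twist_cond e (dconn nabla i u y).
Proof.
move=> prI i u y Uu Fy J a JJ.
pose X : T -> T := cst (lift_N p a, 0).
pose s z := pi_hatN nabla i z (X z).
have fs : foliated_section nabla i setT s.
  move=> z _ _; exists setT, X.
  by split=> //; [exact: openT|exact: foliated_cst].
have tz : twistor i (u, J) by [].
have [A1 [X1 [oO1 O1z _ fX1 sE]]] := prI i setT s openT fs (u, J) Logic.I tz.
have tX1 := proj1 fX1.
have [_ D2] := (foliated_vfieldE nabla_adapted oO1 tX1).1 fX1 _ y O1z tz Fy.
have dX1 : differentiable X1 (u, J) by exact: (proj1 tX1 [::]).
pose C w v := conn_form nabla i v (lift_N p w).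
have X1_2 v : A1 (v, J) -> fol_img i v -> (X1 (v, J)).2 =
    e *: (J *m (0 + ad J (C a v))) - ad J (C (J *m a) v).
  move=> Ov Uv; have := sE _ Ov (conj Uv JJ).
  rewrite /s !pi_hatNE// IE /= lift_NK => -[<-] ->.
  by rewrite addrK.
have dC w : is_derive u y (C w) (dconn nabla i u y w).
  by apply: derivableP; exact: conn_form_derivable.
pose h v := e *: (J *m (0 + ad J (C a v))) - ad J (C (J *m a) v).
have hE : 'D_y h u = e *: (J *m ad J (dconn nabla i u y a))
    - ad J (dconn nabla i u y (J *m a)).
  have [_] := @is_derive_twist _ _ _ u y e J (cst 0) (C a) (C (J *m a)) _ _ _
    (is_derive_cst _ _ _) (dC a) (dC (J *m a)).
  by rewrite add0r.
(* The formula for the matrix component is known only at the chosen J, hence the comparison along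
   the line in direction (y, 0). *)
have := near_line_setI (f := fun z => (X1 z).2) (g := fun z => h z.1)
  y oO1 O1z Uu JJ X1_2.
rewrite derive_snd// D2 derive_comp_fst /= hE => /esym/eqP.
by rewrite subr_eq0 => /eqP.
Qed.

(** The connection matrix of lift a, expanded in the frame: [conn_form] is known to be smooth only
    for a fixed vector, while a will vary with the point. *)
Definition frame_conn (i : fol_idx F) (a : 'cV[R]_m) (u : 'cV[R]_(p + m)) :
    'M[R]_m :=
  \sum_(b < m) a b 0 *: conn_form nabla i u (lift_N p (delta_mx b 0)).

Lemma cV_sum_delta (a : 'cV[R]_m) : a = \sum_(b < m) a b 0 *: delta_mx b 0.
Proof.
by rewrite [LHS]matrix_sum_delta; apply: eq_bigr => b _; rewrite big_ord1.
Qed.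

Lemma linear_cV_sum (W : lmodType R) (L : 'cV[R]_m -> W) a : linear L ->
  L a = \sum_(b < m) a b 0 *: L (delta_mx b 0).
Proof.
move=> Ll; pose LM := GRing.isLinear.Build R 'cV[R]_m W *:%R L Ll.
pose LL : {linear 'cV[R]_m -> W} := HB.pack L LM.
rewrite [a in LHS]cV_sum_delta -[L]/(LL : _ -> _) linear_sum.
by apply: eq_bigr => b _; rewrite linearZ.
Qed.

Lemma frame_connE (i : fol_idx F) a u : fol_img i u ->
  frame_conn i a u = conn_form nabla i u (lift_N p a).
Proof.
move=> Uu.
rewrite (@linear_cV_sum _ (fun a => conn_form nabla i u (lift_N p a)))//.
by move=> c a1 a2; rewrite lift_N_linear (conn_linear nabla Uu).
Qed.

Lemma is_derive_frame_conn (i : fol_idx F) (alpha : T -> 'cV[R]_m) (z : T) y :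
  fol_img i z.1 -> is_derive z ((y, 0) : T) alpha 0 ->
  is_derive z ((y, 0) : T) (fun z => frame_conn i (alpha z) z.1)
    (dconn nabla i z.1 y (alpha z)).
Proof.
move=> Uz Da.
have -> : (fun z => frame_conn i (alpha z) z.1) = \sum_(b < m)
    (fun z => alpha z b 0 *: conn_form nabla i z.1 (lift_N p (delta_mx b 0))).
  by apply/funext => z'; rewrite fct_sumE.
rewrite (linear_cV_sum (alpha z) (dconn_linear nabla y Uz)).
apply: is_derive_sum => b.
have Dab : is_derive z ((y, 0) : T) (fun z => alpha z b 0) 0.
  have Ll : linear (fun A : 'cV[R]_m => A b 0) by move=> a B C; rewrite !mxE.
  have := is_derive_lin Ll (continuous_mx_lin Ll) Da.
  by rewrite mxE.
have Dc : is_derive z ((y, 0) : T)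
    (fun z => conn_form nabla i z.1 (lift_N p (delta_mx b 0)))
    (dconn nabla i z.1 y (delta_mx b 0)).
  have /derivableP [dC DE] := @conn_form_derivable _ _ _ _ _ nabla i _ y
    (lift_N p (delta_mx b 0)) Uz.
  exact: DeriveDef.
by have := is_derive_scale Dab Dc; rewrite scale0r add0r.
Qed.

Lemma smooth_frame_conn (i : fol_idx F) (alpha : T -> 'cV[R]_m) (O : set T) :
  open O -> (forall z, O z -> fol_img i z.1) -> smooth_on O alpha ->
  smooth_on O (fun z => frame_conn i (alpha z) z.1).
Proof.
move=> oO OU sa; apply: smooth_on_sum => // b; apply: smooth_on_scale => //.
  by have /smooth_on_mxP := sa; apply.
exact: smooth_on_fst OU (conn_smooth _ _).
Qed.

(* If the foliated lift X has the components (lift a, A) in the chart, then I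
   sends its class to that of
   (lift (J a), e J (A + [G(a), J]) - [G(J a), J]),
   where G(a) is the connection matrix of lift a. *)
Lemma twist_cond_projectable :
  (forall (i : fol_idx F) u y, fol_img i u -> in_F y ->
     twist_cond e (dconn nabla i u y)) -> projectable nabla I.
Proof.
move=> hT i O s oO fs z Oz tz.
have [A1 [X [oA1 A1z A1O fX sE]]] := fs z Oz tz.
have [sX tgX] := proj1 fX.
have /(foliated_vfieldE nabla_adapted oA1 (proj1 fX)) DX := fX.
pose A2 := A1 `&` fst @^-1` fol_img i.
have oA2 : open A2.
  apply: openI => //.
  by apply: open_comp; [move=> y _; exact: cvg_fst|exact: fol_img_open].
have A2U z' : A2 z' -> fol_img i z'.1 by case.
have A21 : A2 `<=` A1 by move=> ? [].
pose a (z : T) := dsubmx (X z).1.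
pose V z := e *: (z.2 *m ((X z).2 + ad z.2 (frame_conn i (a z) z.1)))
  - ad z.2 (frame_conn i (z.2 *m a z) z.1).
pose X' (z : T) : T := (lift_N p (z.2 *m a z), V z).
have sX1 : smooth_on A2 (fun z => (X z).1).
  apply: (@smooth_on_linear _ _ _ oA2 _ _ fst); first exact: fst_cont.
  exact: smooth_onS sX.
have sX2 : smooth_on A2 (fun z => (X z).2).
  apply: (@smooth_on_linear _ _ _ oA2 _ _ snd); first exact: snd_cont.
  exact: smooth_onS sX.
have sJ : smooth_on A2 (fun z : T => z.2).
  apply: (@smooth_on_linear _ _ _ oA2 _ _ snd); first exact: snd_cont.
  exact: smooth_on_id.
have sa : smooth_on A2 a.
  by apply: smooth_on_mx_lin => //; exact: linearP.
have sJa : smooth_on A2 (fun z => z.2 *m a z) by exact: smooth_on_mulmx.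
have sad (f : T -> 'M[R]_m) :
    smooth_on A2 f -> smooth_on A2 (fun z => ad z.2 (f z)).
  by move=> sf; apply: smooth_onB => //; exact: smooth_on_mulmx.
have sX' : smooth_on A2 X'.
  apply: smooth_on_pair => //.
    by apply: smooth_on_mx_lin => //; exact: lift_N_linear.
  apply: smooth_onB => //; last by apply: sad; exact: smooth_frame_conn.
  apply: smooth_onZ => //; apply: smooth_on_mulmx => //.
  apply: smooth_onD => //.
  by apply: sad; exact: smooth_frame_conn.
have tX' : twistor_vfield i A2 X'.
  split=> // z' A2z' tz'; have JJ := proj2 tz'.
  by apply: anticomm_twist => //; apply: tgX => //; exact: A21.
exists A2, X'; split=> //.
- by split=> //; case: tz.
- by move=> ? /A21 /A1O.
- apply/foliated_vfieldE => // z' y A2z' tz' Fy.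
  have Uz' := A2U _ A2z'; have JJ := proj2 tz'.
  have [D1 D2] := DX z' y (A21 _ A2z') tz' Fy.
  have dX : differentiable X z' by apply: (sX [::]); exact: A21.
  have dX' : differentiable X' z' by exact: (sX' [::]).
  have Da : is_derive z' ((y, 0) : T) a 0.
    have da : differentiable a z'.
      by apply: differentiable_mx_linear; exact: differentiable_fst.
    have dav : derivable a z' ((y, 0) : T) by exact: diff_derivable.
    have := derivableP dav.
    rewrite /a derive_mx_linear; last exact: differentiable_fst.
    by rewrite derive_fst//= D1.
  (* From here J is frozen: the direction (y, 0) leaves it unchanged. *)
  case: z' => u J /= in A2z' tz' Uz' JJ D1 D2 dX dX' Da *.
  have Ll : linear (fun w : 'cV[R]_m => J *m w).
    by move=> c w w'; rewrite linearP.
  have DJa : is_derive ((u, J) : T) ((y, 0) : T) (fun z => J *m a z) 0.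
    by have := is_derive_lin Ll (continuous_mx_lin Ll) Da; rewrite mulmx0.
  have G1 := @is_derive_frame_conn i a (u, J) y Uz' Da.
  have G2 := @is_derive_frame_conn i (fun z => J *m a z) (u, J) y Uz' DJa.
  have DX2 : is_derive ((u, J) : T) ((y, 0) : T) (fun z => (X z).2) 0.
    have dX2 : derivable (fun z => (X z).2) (u, J) ((y, 0) : T).
      by apply: diff_derivable; exact: differentiable_snd.
    by have := derivableP dX2; rewrite derive_snd// D2.
  split.
    rewrite /in_F -derive_fst// -derive_mx_linear; last first.
      exact: differentiable_fst.
    have := near_line_setI (f := fun z => dsubmx (X' z).1)
      (g := fun z => J *m a z) y oA2 A2z' Uz' JJ => ->; first by case: DJa.
    by move=> v _ _; rewrite /= lift_NK.
  rewrite -derive_snd//.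
  have := near_line_setI (f := fun z => (X' z).2) (g := fun z =>
    e *: (J *m ((X z).2 + ad J (frame_conn i (a z) z.1)))
    - ad J (frame_conn i (J *m a z) z.1)) y oA2 A2z' Uz' JJ => -> //.
  have [_ ->] := is_derive_twist e J DX2 G1 G2.
  (* As a and the matrix component of X are constant along y, only the connection matrices
     contribute, and their derivatives form the defect of the twist condition. *)
  by rewrite add0r (hT _ _ _ Uz' Fy J (a (u, J)) JJ) subrr.
move=> z' A2z' tz'; have Uz' := A2U _ A2z'.
rewrite sE//; last exact: A21.
rewrite !pi_hatNE// IE /= lift_NK /V !frame_connE// subrK//.
Qed.

End Projectable.
(** * Curvature conditions *)

Section CurvatureConditions.
Variables (R : realType) (M : topologicalType) (p q : nat).
Variables (F : foliated_atlas R M p (2 * q)) (nabla : connection F).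
Hypothesis nabla_adapted : adapted nabla.
Hypothesis q_gt0 : (1 <= q)%N.

Definition rank_one_form m (rho : 'cV[R]_m -> 'M[R]_m) (l u : 'rV[R]_m) :
    Prop :=
  forall a, rho a = ((l *m a) 0 0)%:M + a *m u.

Lemma rank_one_form_mul m (rho : 'cV[R]_m -> 'M[R]_m) l u a (b : 'cV[R]_m) :
  rank_one_form rho l u -> rho a *m b = (l *m a) 0 0 *: b + (u *m b) 0 0 *: a.
Proof.
move=> ->; rewrite mulmxDl mul_scalar_mx -mulmxA; congr (_ + _).
by rewrite {1}[u *m b]mx11_scalar mul_mx_scalar.
Qed.

Lemma dconn_form1 (i : fol_idx F) u y : fol_img i u ->
  twist_cond 1 (dconn nabla i u y) ->
  exists l w, rank_one_form (dconn nabla i u y) l w.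
Proof.
move=> Uu tc; pose DM := GRing.isLinear.Build R 'cV[R]_(2 * q) 'M[R]_(2 * q)
  *:%R (dconn nabla i u y) (dconn_linear nabla y Uu).
pose D : {linear 'cV[R]_(2 * q) -> 'M[R]_(2 * q)} :=
  HB.pack (dconn nabla i u y) DM.
exact: (@twist_cond1_form _ _ D q_gt0 tc).
Qed.

(** Provides the second vector that separates the two coefficients. Only t is isolated, so z = 0,
    that is X tangent to the leaves, is allowed. *)
Lemma exists_independent_delta (z : 'cV[R]_(2 * q)) :
  exists k, forall s t : R, s *: z + t *: delta_mx k 0 = 0 -> t = 0.
Proof.
have k0 : (0 < 2 * q)%N by lia.
have [z0|z0] := eqVneq z 0.
  exists (Ordinal k0) => s t; rewrite z0 scaler0 add0r.
  move=> /colP/(_ (Ordinal k0)).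
  by rewrite !mxE eqxx mulr1.
have [i zi] : exists i, z i 0 != 0.
  apply/existsP; apply: contraNT z0 => /existsPn H; apply/eqP/colP => i.
  by rewrite mxE; have := H i; rewrite negbK => /eqP.
(* The pairing serves here as a map without fixed points, giving an index other than i. *)
have [p' [f pf]] := pairing_exists R q.
exists (p' i) => s t /colP H.
have := H i; rewrite !mxE eq_sym (negPf (pairing_neq i pf)) mulr0 addr0.
move=> /eqP; rewrite mulf_eq0 (negPf zi) orbF => /eqP s0.
by have := H (p' i); rewrite !mxE s0 mul0r add0r eqxx mulr1.
Qed.

Section AtPoint.
Variables (x : M) (i : fol_idx F).
Hypothesis dx : fol_dom i x.
Let u := fol_phi i x.
Let Uu : fol_img i u. Proof. by exists x. Qed.

Lemma curv_cond_gen_twist lambda mu Y : in_F Y ->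
  curv_cond_gen nabla i x lambda mu -> twist_cond 1 (dconn nabla i u Y).
Proof.
move=> FY cg; apply: (twist_cond_proportional
  (lambda := fun a => - lambda (lift_N p a) Y)
  (mu := fun b => - mu (lift_N p b) Y)).
move=> a b; have := cg (lift_N p a) Y (lift_N p b) FY.
rewrite riemE// !lift_NK => /(congr1 -%R); rewrite opprK => ->.
by rewrite opprD !scaleNr.
Qed.

Lemma riem_form X Y w l v : in_F Y -> rank_one_form (dconn nabla i u Y) l v ->
  riem nabla i x X Y w
  = - (l *m dsubmx X) 0 0 *: w + - (v *m w) 0 0 *: dsubmx X.
Proof.
by move=> FY lv; rewrite riemE// (rank_one_form_mul _ _ lv) opprD !scaleNr.
Qed.

Lemma twist_curv_cond_gen :
  (forall Y, in_F Y -> twist_cond 1 (dconn nabla i u Y)) ->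
  exists lambda mu, curv_cond_gen nabla i x lambda mu.
Proof.
move=> tc.
(* The default (0, 0) for Y outside F makes the existence statement total, so that choice
   applies. *)
have lvP (Y : 'cV[R]_(p + 2 * q)) : exists lv : 'rV[R]_(2 * q) * 'rV[R]_(2 * q),
    in_F Y -> rank_one_form (dconn nabla i u Y) lv.1 lv.2.
  have [FY|nFY] := pselect (in_F Y); last by exists (0, 0).
  by have [l [v lv]] := dconn_form1 Uu (tc _ FY); exists (l, v).
have [lv {}lvP] := choice lvP.
exists (fun X Y => - ((lv Y).1 *m dsubmx X) 0 0),
       (fun Z Y => - ((lv Y).2 *m dsubmx Z) 0 0) => X Y Z FY.
exact: riem_form (lvP _ FY).
Qed.

Lemma curv_cond_gen_q1 lambda mu : curv_cond_gen nabla i x lambda mu ->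
  curv_cond_q1 nabla i x (fun X Y => lambda X Y + mu X Y).
Proof. by move=> cg X Y FY; rewrite cg// scalerDl. Qed.

Lemma curv_cond_q1_form nu Y : q = 1%N -> in_F Y ->
  curv_cond_q1 nabla i x nu ->
  exists l v, rank_one_form (dconn nabla i u Y) l v.
Proof.
move=> q1 FY cq; pose DM := GRing.isLinear.Build R 'cV[R]_(2 * q) 'M[R]_(2 * q)
  *:%R (dconn nabla i u Y) (dconn_linear nabla Y Uu).
pose D : {linear 'cV[R]_(2 * q) -> 'M[R]_(2 * q)} :=
  HB.pack (dconn nabla i u Y) DM.
apply: (@diag_proportional_form _ _ D (fun a => - nu (lift_N p a) Y)).
  by rewrite q1.
move=> a; have := cq (lift_N p a) Y FY; rewrite riemE// !lift_NK.
by move=> /(congr1 -%R); rewrite opprK scaleNr.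
Qed.

Lemma form_twist Y l v : rank_one_form (dconn nabla i u Y) l v ->
  twist_cond 1 (dconn nabla i u Y).
Proof.
move=> lv; apply: (twist_cond_proportional (lambda := fun a => (l *m a) 0 0)
  (mu := fun b => (v *m b) 0 0)) => a b.
exact: rank_one_form_mul.
Qed.

(** Together with [ric_form] this says tr R = 2q lambda + mu and Ric = lambda + 2q mu. The
    determinant of this system is 4q^2 - 1, the denominator of the explicit coefficients; for q = 1
    the sum of the two lines gives 3 nu. *)
Lemma tr_riem_form X Y l v : in_F Y -> rank_one_form (dconn nabla i u Y) l v ->
  tr_riem nabla i x X Y =
  - ((2 * q)%:R * (l *m dsubmx X) 0 0 + (v *m dsubmx X) 0 0).
Proof.
move=> FY lv; rewrite tr_riemE// lv mxtraceD mxtrace_scalar mxtrace_mulC.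
by rewrite [X in _ + X]big_ord1 mulr_natl.
Qed.

Lemma ric_form X Y l v : in_F Y -> rank_one_form (dconn nabla i u Y) l v ->
  ric nabla i x Y X =
  - ((l *m dsubmx X) 0 0 + (2 * q)%:R * (v *m dsubmx X) 0 0).
Proof.
move=> FY lv; rewrite ricE//; congr (- _).
under eq_bigr => a _ do rewrite (rank_one_form_mul _ _ lv) mxE.
rewrite big_split /=; congr (_ + _).
  rewrite mxE; apply: eq_bigr => a _; rewrite -colE !mxE//.
under eq_bigr => a _ do rewrite !mxE !eqxx mulr1.
rewrite sumr_const card_ord mulr_natl mxE//.
Qed.

Lemma twistN1_curv_cond_I2 :
  (forall Y, in_F Y -> twist_cond (-1) (dconn nabla i u Y)) ->
  exists alpha, curv_cond_I2 nabla i x alpha.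
Proof.
move=> tc.
have lP (Y : 'cV[R]_(p + 2 * q)) : exists l : 'rV[R]_(2 * q),
    in_F Y -> forall a, dconn nabla i u Y a = ((l *m a) 0 0)%:M.
  have [FY|nFY] := pselect (in_F Y); last by exists 0.
  pose DM := GRing.isLinear.Build R 'cV[R]_(2 * q) 'M[R]_(2 * q)
    *:%R (dconn nabla i u Y) (dconn_linear nabla Y Uu).
  pose D : {linear 'cV[R]_(2 * q) -> 'M[R]_(2 * q)} :=
    HB.pack (dconn nabla i u Y) DM.
  by have [l lE] := @twist_condN1_scalar _ _ D (tc _ FY); exists l.
have [l {}lP] := choice lP.
exists (fun X Y => - (l Y *m dsubmx X) 0 0) => X Y FY w.
by rewrite riemE// lP// mul_scalar_mx scaleNr.
Qed.

Lemma curv_cond_I2_twist e alpha Y : in_F Y ->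
  curv_cond_I2 nabla i x alpha -> twist_cond e (dconn nabla i u Y).
Proof.
move=> FY ca.
apply: (@twist_cond_scalar _ _ e _ (fun a => - alpha (lift_N p a) Y)).
move=> a b; have := ca (lift_N p a) Y FY b; rewrite riemE// !lift_NK.
by move=> /(congr1 -%R); rewrite opprK scaleNr.
Qed.

Lemma curv_cond_I2_trace alpha X Y : in_F Y ->
  curv_cond_I2 nabla i x alpha ->
  tr_riem nabla i x X Y = (2 * q)%:R * alpha X Y.
Proof.
move=> FY ca; rewrite /tr_riem /tr_end.
under eq_bigr => a _ do rewrite ca// !mxE !eqxx mulr1.
by rewrite sumr_const card_ord mulr_natl.
Qed.

(** For e_k independent of the projection of X, the pair (X, e_k) isolates lambda(X,Y) and the pair
    (e_k, X) isolates mu(X,Y). *)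
Lemma curv_cond_gen_unique lambda mu X Y l v : in_F Y ->
  rank_one_form (dconn nabla i u Y) l v -> curv_cond_gen nabla i x lambda mu ->
  lambda X Y = - (l *m dsubmx X) 0 0 /\ mu X Y = - (v *m dsubmx X) 0 0.
Proof.
move=> FY lv cg; have [k kP] := exists_independent_delta (dsubmx X).
have rE X' Z : (mu Z Y + (v *m dsubmx Z) 0 0) *: dsubmx X'
    + (lambda X' Y + (l *m dsubmx X') 0 0) *: dsubmx Z = 0.
  have := cg X' Y Z FY; rewrite (riem_form _ _ FY lv) => /eqP.
  rewrite eq_sym -subr_eq0 opprD -!scaleNr !opprK => /eqP <-.
  by rewrite !scalerDl addrACA; congr (_ + _); exact: addrC.
have := rE X (lift_N p (delta_mx k 0)); rewrite lift_NK => /kP hl.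
have := rE (lift_N p (delta_mx k 0)) X; rewrite lift_NK addrC => /kP hm.
by split; apply/eqP; rewrite -addr_eq0; apply/eqP.
Qed.

End AtPoint.
End CurvatureConditions.

(** * The equivalences and the explicit coefficients *)

Theorem theorem3p1 (R : realType) (M : topologicalType)
    (hausM : hausdorff_space M) (countM : @second_countable M)
    (p q : nat) (q_gt0 : (1 <= q)%N)
    (F : foliated_atlas R M p (2 * q)) (nabla : connection F)
    (nabla_adapted : adapted nabla) :
  ((projectable nabla (@tw_I1 R (2 * q)) <->
     ((2 <= q)%N /\
       forall (x : M) (i : fol_idx F), fol_dom i x ->
         exists lambda mu, curv_cond_gen nabla i x lambda mu)
     \/
     (q = 1%N /\
       forall (x : M) (i : fol_idx F), fol_dom i x ->
         exists nu, curv_cond_q1 nabla i x nu))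
   /\
   ((2 <= q)%N ->
     forall (x : M) (i : fol_idx F), fol_dom i x ->
     forall lambda mu, curv_cond_gen nabla i x lambda mu ->
     forall X Y : 'cV[R]_(p + 2 * q), in_F Y ->
     [/\ lambda X Y = (2 * q%:R * tr_riem nabla i x X Y - ric nabla i x Y X)
                      / (4 * q%:R ^+ 2 - 1),
         lambda X Y = tr_riem nabla i x X Y / (2 * q%:R + 1)
                      - tr_nabla_tors nabla i x X Y / (4 * q%:R ^+ 2 - 1),
         mu X Y = (tr_riem nabla i x X Y - 2 * q%:R * ric nabla i x Y X)
                  / (1 - 4 * q%:R ^+ 2) &
         mu X Y = tr_riem nabla i x X Y / (2 * q%:R + 1)
                  + 2 * q%:R / (4 * q%:R ^+ 2 - 1)
                    * tr_nabla_tors nabla i x X Y])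
   /\
   (q = 1%N ->
     forall (x : M) (i : fol_idx F), fol_dom i x ->
     forall nu, curv_cond_q1 nabla i x nu ->
     forall X Y : 'cV[R]_(p + 2 * q), in_F Y ->
     dsubmx X <> 0 \/ scalar (fun X' => nu X' Y) ->
     nu X Y = 3^-1 * (tr_riem nabla i x X Y + ric nabla i x Y X)
     /\ nu X Y = 2 / 3 * tr_riem nabla i x X Y
                 + 3^-1 * tr_nabla_tors nabla i x X Y))
  /\
  ((projectable nabla (@tw_I2 R (2 * q)) <->
     forall (x : M) (i : fol_idx F), fol_dom i x ->
       exists alpha, curv_cond_I2 nabla i x alpha)
   /\
   (forall (x : M) (i : fol_idx F), fol_dom i x ->
     forall alpha, curv_cond_I2 nabla i x alpha ->
     forall X Y : 'cV[R]_(p + 2 * q), in_F Y ->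
     alpha X Y = (2 * q%:R)^-1 * tr_riem nabla i x X Y)
   /\
   (projectable nabla (@tw_I2 R (2 * q)) ->
    projectable nabla (@tw_I1 R (2 * q)))).
Proof.
have m0 : 0 < q%:R :> R by rewrite ltr0n.
have mE : (2 * q)%:R = 2 * q%:R :> R by rewrite natrM.
have I1E (J : 'M[R]_(2 * q)) t : tw_I1 J t = (J *m t.1, 1 *: (J *m t.2)).
  by rewrite /tw_I1 scale1r.
have I2E (J : 'M[R]_(2 * q)) t : tw_I2 J t = (J *m t.1, -1 *: (J *m t.2)).
  by rewrite /tw_I2 scaleN1r.
have pr1 := projectable_twist_cond nabla_adapted I1E.
have pr1' := twist_cond_projectable nabla_adapted I1E.
have pr2 := projectable_twist_cond nabla_adapted I2E.
have pr2' := twist_cond_projectable nabla_adapted I2E.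
have at_img i u : fol_img (F := F) i u ->
    exists2 x, fol_dom i x & fol_phi i x = u.
  by case=> x dx <-; exists x.
have in_img (i : fol_idx F) x : fol_dom i x -> fol_img i (fol_phi i x).
  by move=> dx; exists x.
(* A scalar rho commutes with J, so both sides of the condition vanish for either sign e: this
   serves the converse for I_2 and also the implication from I_2 to I_1. *)
have I2I1 : (forall (x : M) (i : fol_idx F), fol_dom i x ->
    exists alpha, curv_cond_I2 nabla i x alpha) ->
    forall e (i : fol_idx F) u y, fol_img i u -> in_F y ->
    twist_cond e (dconn nabla i u y).
  move=> H e i u y /at_img [x dx <-] Fy; have [alpha ca] := H x i dx.
  exact: curv_cond_I2_twist ca.
have pr2P : projectable nabla (@tw_I2 R (2 * q)) <->
    forall (x : M) (i : fol_idx F), fol_dom i x ->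
      exists alpha, curv_cond_I2 nabla i x alpha.
  split=> [pr x i dx|H]; last by apply: pr2' => i u y; exact: I2I1.
  by apply: twistN1_curv_cond_I2 => // Y FY; apply: pr2 => //; exact: in_img.
split; last first.
  split=> //; split=> [x i dx alpha ca X Y FY|/pr2P H].
    rewrite (curv_cond_I2_trace X FY ca) mE mulKf//.
    by rewrite mulf_neq0// ?pnatr_eq0 ?gt_eqF.
  by apply: pr1' => i u y; exact: I2I1.
have Q1 : 1 <= q%:R :> R by rewrite ler1n.
split; last first.
  split.
    move=> q2 x i dx lambda mu cg X Y FY.
    have [l [v lv]] : exists l v,
        rank_one_form (dconn nabla i (fol_phi i x) Y) l v.
      apply: dconn_form1 => //; first exact: in_img.
      exact: curv_cond_gen_twist cg.
    have [-> ->] := curv_cond_gen_unique nabla_adapted q_gt0 dx X FY lv cg.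
    rewrite (tr_nabla_torsE nabla_adapted _ dx FY).
    rewrite (tr_riem_form nabla_adapted dx _ FY lv).
    rewrite (ric_form nabla_adapted dx _ FY lv).
    rewrite mE; have h1 : 4 * q%:R ^+ 2 - 1 != 0 :> R by rewrite gt_eqF//; nra.
    have h2 : 1 - 4 * q%:R ^+ 2 != 0 :> R by rewrite lt_eqF//; nra.
    have h3 : 2 * q%:R + 1 != 0 :> R by rewrite gt_eqF//; lra.
    by split; field; rewrite ?h1 ?h2 ?h3.
  move=> q1 x i dx nu cq X Y FY nuX.
  have [l [v lv]] := curv_cond_q1_form nabla_adapted dx q1 FY cq.
  have nuE X' : dsubmx X' <> 0 ->
      nu X' Y = - ((l *m dsubmx X') 0 0 + (v *m dsubmx X') 0 0).
    move=> X0; have := cq X' Y FY.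
    rewrite (riem_form nabla_adapted dx _ _ FY lv).
    rewrite -scalerDl => /eqP; rewrite -subr_eq0 -scalerBl scaler_eq0.
    rewrite subr_eq0 => /orP[/eqP <-|/eqP//]; by rewrite opprD.
  rewrite (tr_nabla_torsE nabla_adapted _ dx FY).
  rewrite (tr_riem_form nabla_adapted dx _ FY lv).
  rewrite (ric_form nabla_adapted dx _ FY lv).
  have -> : nu X Y = - ((l *m dsubmx X) 0 0 + (v *m dsubmx X) 0 0).
    (* When X projects to 0 the curvature condition does not constrain nu(X,Y). Additivity does:
       adding X to a vector with nonzero projection does not change the projection, hence nu(X,Y) =
       0. *)
    have [X0|X0] := pselect (dsubmx X = 0); last exact: nuE.
    case: nuX => [//|nul].
    have k0 : (0 < 2 * q)%N by lia.
    pose X0' := lift_N p (delta_mx (Ordinal k0) 0 : 'cV[R]_(2 * q)).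
    have X0'0 : dsubmx X0' <> 0.
      rewrite lift_NK => /colP/(_ (Ordinal k0)); rewrite !mxE eqxx.
      by apply/eqP; exact: oner_neq0.
    have XE : dsubmx (1 *: X0' + X) = dsubmx X0'.
      by rewrite linearP/= X0 addr0 scale1r.
    have := nul 1 X0' X.
    rewrite /= mul1r (nuE _ X0'0) nuE XE // -{1}[X in X = _]addr0 => /addrI <-.
    by rewrite X0 !mulmx0 mxE addr0 oppr0.
  have qR : q%:R = 1 :> R by rewrite q1.
  by rewrite mE qR; split; field.
(* The two-coefficient form follows for every q >= 1; for q = 1 it specializes at Z = X, with nu =
   lambda + mu. *)
have genP x i : fol_dom (f := F) i x -> projectable nabla (@tw_I1 R (2 * q)) ->
    exists lambda mu, curv_cond_gen nabla i x lambda mu.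
  move=> dx pr; apply: twist_curv_cond_gen => // Y FY.
  by apply: pr1 => //; exact: in_img.
split=> [pr|].
  have [q2|q2] := leqP 2 q; first by left; split=> // x i dx; exact: genP.
  right; split=> [|x i dx]; first by lia.
  have [lambda [mu cg]] := genP x i dx pr.
  by exists (fun X Y => lambda X Y + mu X Y); exact: curv_cond_gen_q1.
move=> H; apply: pr1' => i u y /at_img [x dx <-] Fy; case: H => [[_ H]|[q1 H]].
  by have [lambda [mu cg]] := H x i dx; exact: curv_cond_gen_twist cg.
have [nu cq] := H x i dx.
have [l [v lv]] := curv_cond_q1_form nabla_adapted dx q1 Fy cq.
exact: form_twist lv.
Qed.
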